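(* Let $A$ and $B$ be finite-dimensional $\mathsf{k}$-algebras over an algebraically closed field $\mathsf{k}$. Then $$\mathsf{FPdim}(A\otimes_{\mathsf k} B)\ \ge\ \mathsf{FPdim}(A)+\mathsf{FPdim}(B),$$ where the inequality is read in $[0,\infty]$.
   Context: $\mathsf{k}$ is an algebraically closed field. An algebra means a (nonzero, unital, associative) finite-dimensional $\mathsf{k}$-algebra, not assumed connected; modules are finitely generated right modules, and $\mathsf{mod}\,A$ is the category of such $A$-modules. A module $S$ is a brick if $\mathrm{End}_A(S)$ is a division ring (equivalently $\mathrm{End}_A(S)\simeq\mathsf{k}$). A semibrick is a (possibly empty) set $\mathcal S$ of pairwise non-isomorphic bricks with $\mathrm{Hom}_A(S,S')=0$ for all non-isomorphic $S,S'\in\mathcal S$. For a finite semibrick $\mathcal S$, the $\mathrm{Ext}$-quiver $Q_{\mathcal S}$ has vertex set $\mathcal S$ and exactly $\dim_{\mathsf k}\mathrm{Ext}^1_A(S,S')$ arrows from $S$ to $S'$ (loops included). For a quiver $Q$, $\rho(Q)$ is the spectral radius (largest modulus of an eigenvalue) of its adjacency matrix, with $\rho=0$ for the empty quiver. The Frobenius--Perron dimension of $A$ is $\mathsf{FPdim}(A)=\sup\{\rho(Q_{\mathcal S})\mid \mathcal S \text{ a finite semibrick in } \mathsf{mod}\,A\}\in[0,\infty]$. *)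

(* Defs.v *)
From HB Require Import structures.
From mathcomp Require Import all_boot all_order all_algebra all_field.
From mathcomp Require Import complex.
From mathcomp Require Import all_classical all_reals all_analysis.

Set Implicit Arguments.
Unset Strict Implicit.
Unset Printing Implicit Defensive.

Import Order.TTheory GRing.Theory Num.Theory.

Local Open Scope classical_set_scope.
Local Open Scope ring_scope.
Local Open Scope complex_scope.

Section TensorSpace.
Variables (k : fieldType) (U V : vectType k).

(* Matrices of coordinates in vbasis {:U} and vbasis {:V}; tens_lift_tens,
   tens_lift_linear and tens_ext are the universal property of U (x) V. *)
Definition tensor : Type := 'M[k]_(\dim {:U}, \dim {:V}).

HB.instance Definition _ :=
  Vector.copy tensor (matrix k (\dim {:U}) (\dim {:V})).

Definition tens (u : U) (v : V) : tensor :=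
  \matrix_(i, j) (coord (vbasis {:U}) i u * coord (vbasis {:V}) j v).

Definition tens_lift (W : lmodType k) (f : U -> V -> W) (x : tensor) : W :=
  \sum_i \sum_j x i j *: f (vbasis {:U})`_i (vbasis {:V})`_j.

Lemma tens_lift_linear (W : lmodType k) (f : U -> V -> W) :
  linear (tens_lift f).
Proof.
move=> c x y; rewrite /tens_lift scaler_sumr -big_split; apply: eq_bigr => i _.
rewrite scaler_sumr -big_split; apply: eq_bigr => j _ /=.
by rewrite !mxE scalerDl scalerA.
Qed.

HB.instance Definition _ (W : lmodType k) (f : U -> V -> W) :=
  GRing.isLinear.Build k tensor W _ (tens_lift f) (tens_lift_linear f).

Lemma tens_linearl v : linear (tens^~ v).
Proof.
by move=> c u u'; apply/matrixP=> i j; rewrite !mxE linearP /= mulrDl mulrA.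
Qed.

Lemma tens_linearr u : linear (tens u).
Proof.
by move=> c v v'; apply/matrixP=> i j; rewrite !mxE linearP /= mulrDr mulrCA.
Qed.

Lemma tens_basisE i j (p : 'I_(\dim {:U})) (q : 'I_(\dim {:V})) :
  tens (vbasis {:U})`_p (vbasis {:V})`_q i j = ((i == p) && (j == q))%:R.
Proof.
rewrite mxE !coord_free ?(basis_free (vbasisP _)) //.
by rewrite -natrM mulnb [p == i]eq_sym [q == j]eq_sym.
Qed.

Lemma tens_lift_tens (W : lmodType k) (f : U -> V -> W)
    (fl : forall v, linear (f^~ v)) (fr : forall u, linear (f u)) u v :
  tens_lift f (tens u v) = f u v.
Proof.
have sumE (X Y : lmodType k) (g : X -> Y) (gl : linear g) n (c : 'I_n -> k) x :
    g (\sum_i c i *: x i) = \sum_i c i *: g (x i).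
  pose gL := GRing.isLinear.Build k X Y _ g gl.
  pose g' : {linear X -> Y} := HB.pack g gL.
  rewrite -[g]/(g' : X -> Y) linear_sum; apply: eq_bigr => i _.
  by rewrite linearZ.
rewrite {2}(coord_vbasis (memvf u)) {2}(coord_vbasis (memvf v)).
rewrite (sumE _ _ (f^~ _)) //.
apply: eq_bigr => i _; rewrite sumE // scaler_sumr; apply: eq_bigr => j _.
by rewrite mxE scalerA.
Qed.

Lemma tens_ext (W : lmodType k) (f g : tensor -> W) (fl : linear f)
    (gl : linear g) : (forall u v, f (tens u v) = g (tens u v)) -> f =1 g.
Proof.
move=> fg x.
have -> : x = tens_lift tens x :> tensor.
  apply: etrans (matrix_sum_delta x) _; apply: eq_bigr => i _.
  apply: eq_bigr => j _; congr (_ *: _).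
  by apply/matrixP=> p q; rewrite tens_basisE mxE.
pose fL := GRing.isLinear.Build k tensor W _ f fl.
pose f' : {linear tensor -> W} := HB.pack f fL.
pose gL := GRing.isLinear.Build k tensor W _ g gl.
pose g' : {linear tensor -> W} := HB.pack g gL.
rewrite -[f]/(f' : tensor -> W) -[g]/(g' : tensor -> W) !linear_sum.
apply: eq_bigr => i _; rewrite !linear_sum; apply: eq_bigr => j _.
by rewrite !linearZ /= fg.
Qed.

End TensorSpace.

Section TensorAlgebra.
Variables (k : fieldType) (A B : falgType k).
Local Notation AB := (tensor A B).

Definition tensor_one : AB := tens 1 1.
Definition tensor_mul (x y : AB) : AB :=
  tens_lift (fun a b => tens_lift (fun a' b' => tens (a * a') (b * b')) y) x.

Lemma tensor_mull y : linear (tensor_mul^~ y).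
Proof. by move=> c x x'; rewrite /tensor_mul linearP. Qed.

Lemma tensor_mulr x : linear (tensor_mul x).
Proof.
move=> c y y'; pose F i j y0 := tens_lift (fun a' b' =>
  tens ((vbasis {:A})`_i * a') ((vbasis {:B})`_j * b')) y0.
change (\sum_i \sum_j x i j *: F i j (c *: y + y') =
  c *: (\sum_i \sum_j x i j *: F i j y) + \sum_i \sum_j x i j *: F i j y').
rewrite scaler_sumr -big_split; apply: eq_bigr => i _.
rewrite scaler_sumr -big_split; apply: eq_bigr => j _ /=.
by rewrite /F tens_lift_linear scalerDr !scalerA [c * _]mulrC.
Qed.

Lemma tensor_mul_tens a b a' b' :
  tensor_mul (tens a b) (tens a' b') = tens (a * a') (b * b').
Proof.
have inner a0 b0 : tens_lift (fun a' b' => tens (a0 * a') (b0 * b'))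
    (tens a' b') = tens (a0 * a') (b0 * b').
  apply: (@tens_lift_tens _ _ _ _ (fun a' b' => tens (a0 * a') (b0 * b'))).
    by move=> v c u u'; rewrite mulrDr -scalerAr tens_linearl.
  by move=> u c v v'; rewrite mulrDr -scalerAr tens_linearr.
rewrite /tensor_mul tens_lift_tens ?inner //.
  by move=> v c u u'; rewrite !(tens_lift_tens, inner) mulrDl -scalerAl tens_linearl.
by move=> u c v v'; rewrite !inner mulrDl -scalerAl tens_linearr.
Qed.

Lemma tensor_mulA : associative tensor_mul.
Proof.
move=> x y z; move: x; apply: tens_ext => [c x x'|c x x'|a b].
- by rewrite tensor_mull.
- by rewrite !tensor_mull.
move: y; apply: tens_ext => [c y y'|c y y'|a' b'].
- by rewrite tensor_mull tensor_mulr.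
- by rewrite tensor_mulr tensor_mull.
move: z; apply: tens_ext => [c z z'|c z z'|a'' b''].
- by rewrite !tensor_mulr.
- by rewrite !tensor_mulr.
by rewrite !tensor_mul_tens !mulrA.
Qed.

Lemma tensor_mul1 : left_id tensor_one tensor_mul.
Proof.
apply: tens_ext => // [c x x'|a b]; first by rewrite tensor_mulr.
by rewrite tensor_mul_tens !mul1r.
Qed.

Lemma tensor_mulr1 : right_id tensor_one tensor_mul.
Proof.
apply: tens_ext => // [c x x'|a b]; first by rewrite tensor_mull.
by rewrite tensor_mul_tens !mulr1.
Qed.

Lemma tensor_mulDl : left_distributive tensor_mul +%R.
Proof. by move=> x y z; rewrite -[x in LHS]scale1r tensor_mull scale1r. Qed.

Lemma tensor_mulDr : right_distributive tensor_mul +%R.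
Proof. by move=> x y z; rewrite -[y in LHS]scale1r tensor_mulr scale1r. Qed.

Lemma tens_eq0 (a : A) (b : B) : (tens a b == 0) = (a == 0) || (b == 0).
Proof.
apply/eqP/idP => [ab0|/orP[/eqP->|/eqP->]]; last 2 first.
- by apply/matrixP=> i j; rewrite !mxE linear0 mul0r.
- by apply/matrixP=> i j; rewrite !mxE linear0 mulr0.
apply: contraT; rewrite negb_or => /andP[a0 b0].
have ex (W : vectType k) (w : W) : w != 0 ->
    exists i, coord (vbasis {:W}) i w != 0.
  move=> w0; apply/existsP; apply: contraR w0; rewrite negb_exists.
  move=> /forallP w0; rewrite (coord_vbasis (memvf w)) big1 // => i _.
  by have /negPn/eqP-> := w0 i; rewrite scale0r.
have [i ai] := ex _ _ a0; have [j bj] := ex _ _ b0.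
have /matrixP/(_ i j)/eqP := ab0.
by rewrite !mxE mulf_eq0 (negPf ai) (negPf bj).
Qed.

Lemma tensor_oner_neq0 : tensor_one != 0.
Proof. by rewrite tens_eq0 !oner_eq0. Qed.

HB.instance Definition _ := GRing.Zmodule_isNzRing.Build AB
  tensor_mulA tensor_mul1 tensor_mulr1 tensor_mulDl tensor_mulDr
  tensor_oner_neq0.

Lemma tensor_scalerAl (c : k) (x y : AB) : c *: (x * y) = (c *: x) * y.
Proof.
rewrite -[c *: x]addr0 [RHS](tensor_mull y c x 0).
by rewrite [X in _ + X](mul0r (y : AB)) addr0.
Qed.

Lemma tensor_scalerAr (c : k) (x y : AB) : c *: (x * y) = x * (c *: y).
Proof.
rewrite -[c *: y]addr0 [RHS](tensor_mulr x c y 0).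
by rewrite [X in _ + X](mulr0 (x : AB)) addr0.
Qed.

HB.instance Definition _ := GRing.Lmodule_isLalgebra.Build k AB tensor_scalerAl.
HB.instance Definition _ := GRing.Lalgebra_isAlgebra.Build k AB tensor_scalerAr.
HB.instance Definition _ := Algebra_isFalgebra.Build k AB.

Lemma tens_mul a b a' b' :
  (tens a b : AB) * tens a' b' = tens (a * a') (b * b').
Proof. exact: tensor_mul_tens. Qed.

Lemma tens11 : tens 1 1 = 1 :> AB.
Proof. by []. Qed.
End TensorAlgebra.

(* Since A is finite-dimensional, a right A-module is finitely generated iff it
   is finite-dimensional over k; the k-structure is the one induced by A, as
   ract_linearr and ract1 give ract v c%:A = c *: v. *)
Record rmodule (k : fieldType) (A : falgType k) := RModule {
  rmod_space :> vectType k;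
  ract : rmod_space -> A -> rmod_space;
  ract_linearl : forall a, linear (ract^~ a);
  ract_linearr : forall v, linear (ract v);
  ract1 : forall v, ract v 1 = v;
  ractM : forall v a b, ract v (a * b) = ract (ract v a) b }.

Section Modules.
Variables (k : fieldType) (A : falgType k).
Implicit Types M N P : rmodule A.

Definition ractr M (a : A) (v : M) : M := ract v a.

HB.instance Definition _ M a :=
  GRing.isLinear.Build k M M _ (@ractr M a) (ract_linearl a).
HB.instance Definition _ M v :=
  GRing.isLinear.Build k A M _ (@ract _ _ M v) (ract_linearr v).

Definition act_end M (a : A) : 'End(M) := linfun (@ractr M a).

Definition hom_defect M N (a : A) (f : 'Hom(M, N)) : 'Hom(M, N) :=
  ((f \o act_end M a) - (act_end N a \o f))%VF.

Lemma hom_defectE M N a (f : 'Hom(M, N)) v :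
  hom_defect a f v = f (ract v a) - ract (f v) a.
Proof. by rewrite add_lfunE opp_lfunE !comp_lfunE !lfunE. Qed.

Lemma hom_defect_linear M N a : linear (@hom_defect M N a).
Proof.
move=> c f g; apply/lfunP => v; rewrite [RHS]add_lfunE [X in _ = X + _]scale_lfunE.
rewrite !hom_defectE.
rewrite !add_lfunE !scale_lfunE -![ract _ a]/(ractr a _) linearP.
by rewrite scalerBr opprD addrACA.
Qed.

HB.instance Definition _ M N a :=
  GRing.isLinear.Build k _ _ _ (@hom_defect M N a) (@hom_defect_linear M N a).

Definition homA M N : {vspace 'Hom(M, N)} :=
  (\bigcap_(i < \dim {:A}) lker (linfun (@hom_defect M N (vbasis {:A})`_i)))%VS.

Lemma homAP M N (f : 'Hom(M, N)) :
  reflect (forall v a, f (ract v a) = ract (f v) a) (f \in homA M N).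
Proof.
apply: (iffP idP) => [/subv_bigcapP fA v a|fA]; last first.
  apply/subv_bigcapP => i _; rewrite -memvE memv_ker lfunE /=.
  by apply/eqP/lfunP => v; rewrite hom_defectE lfunE /= fA subrr.
rewrite (coord_vbasis (memvf a)) !linear_sum; apply: eq_bigr => i _.
rewrite !linearZ; congr (_ *: _); apply/eqP; rewrite -subr_eq0 -hom_defectE.
have := fA i isT; rewrite -memvE memv_ker lfunE /= => /eqP->.
by rewrite lfunE.
Qed.

Definition brick M : Prop :=
  (\1 != 0 :> 'End(M))%VF /\
  forall f, f \in homA M M -> f != 0 ->
    exists2 g, g \in homA M M & (f \o g = \1 /\ g \o f = \1)%VF.

Definition isoA M N : Prop :=
  exists2 f, f \in homA M N &
    exists2 g, g \in homA N M & (f \o g = \1 /\ g \o f = \1)%VF.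

Definition semibrick n (S : 'I_n -> rmodule A) : Prop :=
  [/\ forall i, brick (S i),
      forall i j, i != j -> ~ isoA (S i) (S j) &
      forall i j, ~ isoA (S i) (S j) -> homA (S i) (S j) = 0%VS].

Definition free_act n (x : {ffun 'I_n -> A}) (a : A) : {ffun 'I_n -> A} :=
  [ffun i => x i * a].

Fact free_act_linearl n a : linear ((@free_act n)^~ a).
Proof. by move=> c x y; apply/ffunP => i; rewrite !ffunE mulrDl scalerAl. Qed.
Fact free_act_linearr n x : linear (@free_act n x).
Proof. by move=> c a b; apply/ffunP => i; rewrite !ffunE mulrDr scalerAr. Qed.
Fact free_act1 n x : @free_act n x 1 = x.
Proof. by apply/ffunP => i; rewrite !ffunE mulr1. Qed.
Fact free_actM n x a b : @free_act n x (a * b) = free_act (free_act x a) b.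
Proof. by apply/ffunP => i; rewrite !ffunE mulrA. Qed.

Definition free_rmod n : rmodule A :=
  RModule (@free_act_linearl n) (@free_act_linearr n) (@free_act1 n)
    (@free_actM n).

Definition cover_obj M : rmodule A := free_rmod (\dim {:M}).

Definition cover_fun M (x : cover_obj M) : M :=
  \sum_(i < \dim {:M}) ract (vbasis {:M})`_i (x i).

Fact cover_fun_linear M : linear (@cover_fun M).
Proof.
move=> c x y; rewrite /cover_fun scaler_sumr -big_split.
by apply: eq_bigr => i _; rewrite !ffunE linearP.
Qed.

HB.instance Definition _ M :=
  GRing.isLinear.Build k _ _ _ (@cover_fun M) (@cover_fun_linear M).

Definition cover M : 'Hom(cover_obj M, M) := linfun (@cover_fun M).

Lemma cover_hom M : cover M \in homA (cover_obj M) M.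
Proof.
apply/homAP => x a; rewrite !lfunE /= /cover_fun -[RHS]/(ractr a _) linear_sum.
by apply: eq_bigr => i _; rewrite ffunE ractM.
Qed.

Lemma cover_onto M : limg (cover M) = fullv.
Proof.
apply/eqP; rewrite eqEsubv subvf; apply/subvP => v _; apply/memv_imgP.
exists [ffun i => coord (vbasis {:M}) i v *: 1]; rewrite ?memvf // lfunE /=.
rewrite /cover_fun {1}(coord_vbasis (memvf v)); apply: eq_bigr => i _.
by rewrite ffunE linearZ /= ract1.
Qed.

Section Kernel.
Variables (M N : rmodule A) (f : 'Hom(M, N)) (fA : f \in homA M N).

Definition ker_act (x : subvs_of (lker f)) (a : A) : subvs_of (lker f) :=
  vsproj (lker f) (ract (vsval x) a).

Lemma ker_actE x a : vsval (ker_act x a) = ract (vsval x) a.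
Proof.
rewrite vsprojK // memv_ker; move/homAP: fA => ->.
have /eqP-> : f (vsval x) == 0 by rewrite -memv_ker subvsP.
by rewrite -[ract _ _]/(ractr a _) linear0.
Qed.

Fact ker_act_linearl a : linear (ker_act^~ a).
Proof. by move=> c x y; rewrite /ker_act linearP ract_linearl linearP. Qed.
Fact ker_act_linearr x : linear (ker_act x).
Proof. by move=> c a b; rewrite /ker_act !linearP. Qed.
Fact ker_act1 x : ker_act x 1 = x.
Proof. by apply: val_inj; rewrite /= ker_actE ract1. Qed.
Fact ker_actM x a b : ker_act x (a * b) = ker_act (ker_act x a) b.
Proof. by apply: val_inj; rewrite /= !ker_actE ractM. Qed.

Definition ker_rmod : rmodule A :=
  RModule ker_act_linearl ker_act_linearr ker_act1 ker_actM.

Definition ker_incl : 'Hom(ker_rmod, M) := linfun (@vsval _ _ (lker f)).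

Lemma ker_incl_hom : ker_incl \in homA ker_rmod M.
Proof. by apply/homAP => x a; rewrite !lfunE /= ker_actE. Qed.

Lemma limg_ker_incl : limg ker_incl = lker f.
Proof.
apply/vspaceP => x; apply/memv_imgP/idP => [[y _ ->]|xf].
  by rewrite lfunE subvsP.
by exists (Subvs xf); rewrite ?memvf ?lfunE.
Qed.

Lemma lker_ker_incl : lker ker_incl = 0%VS.
Proof.
by apply/eqP/lker0P => x y; rewrite !lfunE => /val_inj.
Qed.
End Kernel.

Fixpoint syzygy M n : rmodule A :=
  if n is m.+1 then ker_rmod (cover_hom (syzygy M m)) else M.

(* The free resolution ... -> res_obj M 1 -> res_obj M 0 -> M -> 0 obtained by
   covering each successive kernel. *)
Definition res_obj M n : rmodule A := cover_obj (syzygy M n).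
Definition res_diff M n : 'Hom(res_obj M n.+1, res_obj M n) :=
  (ker_incl (cover_hom (syzygy M n)) \o cover (syzygy M n.+1))%VF.

Definition precomp M M' N (d : 'Hom(M', M)) (f : 'Hom(M, N)) : 'Hom(M', N) :=
  (f \o d)%VF.

Fact precomp_linear M M' N (d : 'Hom(M', M)) : linear (@precomp M M' N d).
Proof.
by move=> c f g; rewrite /precomp comp_lfunDl comp_lfunZl.
Qed.

HB.instance Definition _ M M' N (d : 'Hom(M', M)) :=
  GRing.isLinear.Build k _ _ _ (@precomp M M' N d) (precomp_linear d).

Definition codiff M N n : 'Hom('Hom(res_obj M n, N), 'Hom(res_obj M n.+1, N)) :=
  linfun (precomp (res_diff M n)).

Lemma codiffE M N n f : codiff M N n f = (f \o res_diff M n)%VF.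
Proof. by rewrite /codiff lfunE. Qed.

(* Ext^1(M, N) = H^1 (Hom_A(res_obj M _, N)) *)
Definition ext1_cycles M N : {vspace 'Hom(res_obj M 1, N)} :=
  (homA (res_obj M 1) N :&: lker (codiff M N 1))%VS.
Definition ext1_bounds M N : {vspace 'Hom(res_obj M 1, N)} :=
  (codiff M N 0 @: homA (res_obj M 0) N)%VS.
Definition dim_ext1 M N : nat :=
  (\dim (ext1_cycles M N) - \dim (ext1_bounds M N))%N.

Lemma res_exact0 M : limg (res_diff M 0) = lker (cover M).
Proof. by rewrite /res_diff limg_comp cover_onto limg_ker_incl. Qed.

Lemma res_exact M n : limg (res_diff M n.+1) = lker (res_diff M n).
Proof.
rewrite /res_diff limg_comp cover_onto limg_ker_incl.
set c := cover _; set i := ker_incl _.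
apply/vspaceP => x; rewrite !memv_ker comp_lfunE.
have /eqP/lker0P i_inj : lker i = 0%VS by exact: lker_ker_incl.
by rewrite -(inj_eq i_inj) linear0.
Qed.

Lemma comp_homA M N P (f : 'Hom(N, P)) (g : 'Hom(M, N)) :
  f \in homA N P -> g \in homA M N -> (f \o g)%VF \in homA M P.
Proof.
by move=> /homAP fA /homAP gA; apply/homAP => v a; rewrite !comp_lfunE gA fA.
Qed.

Lemma res_diff_hom M n : res_diff M n \in homA (res_obj M n.+1) (res_obj M n).
Proof. exact: comp_homA (ker_incl_hom _) (cover_hom _). Qed.

Lemma ext1_bounds_sub M N : (ext1_bounds M N <= ext1_cycles M N)%VS.
Proof.
apply/subvP => _ /memv_imgP[f fA ->]; rewrite memv_cap memv_ker !codiffE.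
rewrite (comp_homA fA (res_diff_hom M 0)); apply/eqP/lfunP => x.
rewrite 2!comp_lfunE [RHS]zero_lfunE.
have : res_diff M 1 x \in lker (res_diff M 0).
  by rewrite -res_exact; apply: memv_img; apply: memvf.
by rewrite memv_ker => /eqP->; apply: linear0.
Qed.
End Modules.

Section FPdim.
Variables (R : realType) (k : fieldType) (A : falgType k).

(* A quiver on 'I_n is given by its adjacency matrix: entry (i, j) counts the
   arrows from i to j. *)
Definition ext_quiver n (S : 'I_n -> rmodule A) : 'M[nat]_n :=
  \matrix_(i, j) dim_ext1 (S i) (S j).

(* The set of eigenvalues is finite, so sup is a maximum; for n = 0 it is empty
   and sup set0 = 0. *)
Definition spectral_radius n (Q : 'M[nat]_n) : R :=
  sup [set ComplexField.Normc.normc z |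
        z in [set z : R[i] | eigenvalue (map_mx (fun m : nat => m%:R : R[i]) Q) z]].

Definition FPdim : \bar R :=
  ereal_sup [set x | exists n (S : 'I_n -> rmodule A),
    semibrick S /\ x = (spectral_radius (ext_quiver S))%:E].

End FPdim.

(* Main.v *)
(* If S and T are semibricks over A and B, the modules S_i (x) T_j form a
   semibrick over A (x) B, because Hom(S (x) T, S' (x) T') is controlled by its
   contractions, which lie in Hom(S, S') and Hom(T, T').  Ext^1(M, N) is
   identified with the derivations D : M x A -> N modulo the inner ones; then
   (D, E) |-> D (x) h + g (x) E embeds Ext^1(S, S') + Ext^1(T, T') into
   Ext^1(S (x) T, S' (x) T') whenever h : T -> T' and g : S -> S' are nonzero.
   Hence the adjacency matrix of the product semibrick dominates
   Q_S (x) 1 + 1 (x) Q_T.  If x and y are eigenvectors of Q_S and Q_T, then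
   |x| (x) |y| is a subinvariant vector of that matrix, and a subinvariant
   vector bounds the spectral radius from below.  An empty semibrick is first
   replaced by a single brick, as its product with another one is empty. *)
Require Import Defs.
From HB Require Import structures.
From mathcomp Require Import all_boot all_order all_algebra all_field.
From mathcomp Require Import complex polyrcf.
From mathcomp Require Import all_classical all_reals all_analysis.
From mathcomp Require Import ring.

Set Implicit Arguments.
Unset Strict Implicit.
Unset Printing Implicit Defensive.

Import Order.TTheory GRing.Theory Num.Theory.

Local Open Scope ring_scope.
Local Open Scope complex_scope.

(** * Subinvariant vectors of nonnegative matrices *)

Section Perron.
Variable R : rcfType.

Lemma horner_char_poly n (M : 'M[R]_n) t : (char_poly M).[t] = \det (t%:M - M).
Proof.
rewrite -horner_evalE -det_map_mx; congr (\det _).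
apply/matrixP => i j; rewrite !mxE /= /horner_eval !hornerE.
by rewrite hornerMn hornerX.
Qed.

(** Without roots on the half-line the sign is constant there, and it is the sign of the leading
    coefficient. *)
Lemma monic_noroot_gt0 (p : {poly R}) r : p \is monic ->
  (forall t, r <= t -> p.[t] != 0) -> forall t, r <= t -> 0 < p.[t].
Proof.
move=> pm p0 t rt; rewrite -sgr_cp0.
rewrite (@sgp_pinftyP R r p) ?in_itv /= ?rt //.
  by rewrite /sgp_pinfty (monicP pm) sgr1.
by move=> x; rewrite in_itv /= andbT => /p0.
Qed.

Lemma largest_root (p : {poly R}) x : p != 0 -> root p x ->
  exists y, [/\ root p y, x <= y & forall t, y < t -> p.[t] != 0].
Proof.
move=> p0 px; have rE := roots_on_rootsR p0.
have {px}: x \in rootsR p by rewrite -rE inE ?in_itv /=.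
have maxP (s : seq R) : x \in s -> exists2 y, y \in s & forall z, z \in s -> z <= y.
  elim: s x => // a [|b s] IH x; first by move=> _; exists a => [|z]; rewrite ?inE // => /eqP->.
  move=> _; have [//|y ys yM] := IH b; first by rewrite inE eqxx.
  have [ay|ya] := leP a y.
    by exists y => [|z]; rewrite inE ?ys ?orbT // => /orP[/eqP->|/yM].
  exists a => [|z]; rewrite inE ?eqxx // => /orP[/eqP->//|/yM zy].
  exact: le_trans zy (ltW ya).
move=> xs; have [y ys yM] := maxP _ xs.
exists y; split; rewrite ?yM //; first by have := ys; rewrite -rE inE ?in_itv /=.
move=> t yt; apply/negP => pt; have: t \in rootsR p by rewrite -rE inE ?in_itv /=.
by move/yM; rewrite leNgt yt.
Qed.

(** The matrix is the product of [[s, b; 0, D]] and [[1, 0; X c, 1]], where [s] is the Schur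
    complement of [D]. *)
Lemma det_block_schur n (a : R) (b : 'rV[R]_n) (c : 'cV[R]_n) (D X : 'M[R]_n) :
  D *m X = 1%:M ->
  \det (block_mx a%:M b c D : 'M[R]_(1 + n)) = (a - (b *m X *m c) 0 0) * \det D.
Proof.
move=> DX; set s := a - _.
have sE : (s%:M : 'M[R]_1) + b *m (X *m c) = a%:M.
  by rewrite mulmxA [X in _ + X]mx11_scalar -raddfD /= subrK.
have : block_mx a%:M b c D =
    (block_mx s%:M b 0 D : 'M[R]_(1 + n)) *m block_mx 1%:M 0 (X *m c) 1%:M.
  rewrite mulmx_block !(mulmx1, mulmx0, mul0mx, add0r) sE.
  by rewrite mulmxA DX mul1mx.
move->; rewrite det_mulmx det_ublock det_lblock !det_scalar1.
by rewrite det1 !mulr1.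
Qed.

(* Induction on n by Schur complements: at the largest real eigenvalue of the
   principal submatrix D above r, the characteristic polynomial of M would be
   nonpositive, since b *m (t - D)^-1 *m c >= 0 to the right of it. *)
Lemma resolvent_ge0 n (M : 'M[R]_n) r : (forall i j, 0 <= M i j) ->
  (forall t, r <= t -> (char_poly M).[t] != 0) ->
  exists2 N : 'M[R]_n, (r%:M - M) *m N = 1%:M & forall i j, 0 <= N i j.
Proof.
elim: n M r => [|n IH] M r.
  by exists 0; [apply/matrixP => -[] | case].
rewrite -[n.+1]/(1 + n)%N in M *.
rewrite -[M]submxK; set m := ulsubmx M; set b := ursubmx M.
set c := dlsubmx M; set D := drsubmx M => M0 Mr.
have b0 i j : 0 <= b i j by have := M0 (lshift n i) (rshift 1 j); rewrite block_mxEur.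
have c0 i j : 0 <= c i j by have := M0 (rshift 1 i) (lshift n j); rewrite block_mxEdl.
have D0 i j : 0 <= D i j by have := M0 (rshift 1 i) (rshift 1 j); rewrite block_mxEdr.
have mulge0 p q l (F : 'M[R]_(p, q)) (G : 'M[R]_(q, l)) :
    (forall i j, 0 <= F i j) -> (forall i j, 0 <= G i j) ->
    forall i j, 0 <= (F *m G) i j.
  by move=> F0 G0 i j; rewrite mxE sumr_ge0 // => u _; rewrite mulr_ge0.
have tM t : t%:M - block_mx m b c D =
    block_mx (t - m 0 0)%:M (- b) (- c) (t%:M - D) :> 'M[R]_(1 + n).
  rewrite (@scalar_mx_block _ 1 n) opp_block_mx add_block_mx !add0r.
  by rewrite raddfB /= -mx11_scalar.
have detE t X : (t%:M - D) *m X = 1%:M ->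
    (char_poly (block_mx m b c D : 'M[R]_(1 + n))).[t] =
    (t - m 0 0 - (b *m X *m c) 0 0) * (char_poly D).[t].
  move=> tX; rewrite !horner_char_poly tM (det_block_schur _ _ _ tX).
  by rewrite mulmxN !mulNmx opprK.
have Mp := monic_noroot_gt0 (char_poly_monic _) Mr.
have Dr t : r <= t -> (char_poly D).[t] != 0.
  move=> rt; apply/negP => Dt.
  have [y [Dy ty yM]] := largest_root (monic_neq0 (char_poly_monic D)) Dt.
  (* Where [t - D] has an inverse [X], this is [- b X c] times the characteristic polynomial of [D];
     being a polynomial, [h] is also continuous at the root [y]. *)
  pose h := char_poly (block_mx m b c D : 'M[R]_(1 + n))
            - ('X - (m 0 0)%:P) * char_poly D.
  have hy : 0 < h.[y].
    rewrite !hornerE; move/eqP: Dy => ->; rewrite mulr0 subr0.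
    by apply: Mp; apply: le_trans ty.
  have hle u : y < u -> h.[u] <= 0.
    move=> yu; have Du v : u <= v -> (char_poly D).[v] != 0.
      by move=> uv; apply: yM; apply: lt_le_trans uv.
    have [X uX X0] := IH D u D0 Du.
    rewrite !hornerE (detE _ _ uX) subr_le0 ler_wpM2r //.
      exact/ltW/(monic_noroot_gt0 (char_poly_monic D) Du).
    by rewrite lerBlDr lerDl; apply/mulge0 => //; apply/mulge0.
  (* With [h.[y]] itself as tolerance, continuity makes [h] positive at [y + d / 2], against
     [hle]. *)
  have [d d0 dh] := poly_cont y h hy.
  have := dh (y + d / 2); rewrite addrAC subrr add0r gtr0_norm ?divr_gt0 //.
  rewrite ltr_pdivrMr // ltr_pMr // ltr1n => /(_ isT).
  have := hle (y + d / 2); rewrite ltrDl divr_gt0 // => /(_ isT) h0.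
  rewrite ltr_norml => /andP[+ _]; rewrite ltrBrDr addNr.
  by rewrite ltNge h0.
have [X rX X0] := IH D r D0 Dr.
have Dp := monic_noroot_gt0 (char_poly_monic D) Dr.
(* The Schur complement of [r - D] in [r - M]: a quotient of two characteristic polynomials that are
   positive at [r]. *)
set s := r - m 0 0 - (b *m X *m c) 0 0.
have s0 : 0 < s.
  by have := Mp r (lexx r); rewrite (detE _ _ rX) pmulr_lgt0 // Dp.
(* Block inversion through [s]; the off-diagonal blocks [- b] and [- c] of [r - M] turn every sign
   positive. *)
exists (block_mx (s^-1)%:M (s^-1 *: (b *m X)) (s^-1 *: (X *m c))
  (X + s^-1 *: ((X *m c) *m (b *m X)))).
  rewrite tM mulmx_block (@scalar_mx_block _ 1 n).
  rewrite -!scalemxAr !mul_scalar_mx !mulmxDr !mulNmx -!scalemxAr !mulmxA rX mul1mx.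
  have bXc : b *m X *m c = (r - m 0 0 - s)%:M.
    by rewrite [LHS]mx11_scalar; congr (_%:M); rewrite /s; ring.
  rewrite bXc !mul_mx_scalar mul_scalar_mx.
  have sV : s^-1 * s = 1 by rewrite mulVf // gt_eqF.
  congr block_mx.
  - rewrite -raddfN !scale_scalar_mx -raddfD /=; congr (_%:M).
    by rewrite -[RHS]sV; ring.
  - rewrite -scalemxAl !scalerA -scaleN1r -scaleNr -!scalerDl.
    suff -> : s^-1 * (r - m 0 0) + (-1 - s^-1 * (r - m 0 0 - s)) = 0.
      by rewrite scale0r.
    by rewrite -[1]sV; ring.
  - by rewrite addNr.
  - by rewrite scalerN addrC addrK.
have sV0 : 0 <= s^-1 by rewrite invr_ge0 ltW.
have scge0 p q (F : 'M[R]_(p, q)) :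
    (forall i j, 0 <= F i j) -> forall i j, 0 <= (s^-1 *: F) i j.
  by move=> F0 i j; rewrite mxE mulr_ge0.
move=> i j; case: (split_ordP i) => i' ->; case: (split_ordP j) => j' ->.
- by rewrite block_mxEul !mxE mulrn_wge0.
- by rewrite block_mxEur; apply/scge0/mulge0.
- by rewrite block_mxEdl; apply/scge0/mulge0.
by rewrite block_mxEdr mxE addr_ge0 //; apply/scge0/mulge0; apply/mulge0.
Qed.

(** Otherwise [r - M] has a nonnegative right inverse [N], and [w = w (r - M) N] with
    [w (r - M) <= 0] gives [w <= 0], hence [w = 0]. *)
Lemma subinvariant_eigenvalue n (M : 'M[R]_n) (w : 'rV[R]_n) r :
  (forall i j, 0 <= M i j) -> (forall j, 0 <= w 0 j) -> w != 0 ->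
  (forall j, r * w 0 j <= (w *m M) 0 j) ->
  exists2 t, r <= t & eigenvalue M t.
Proof.
move=> M0 w0 wn0 wM; have [//|nex] := pselect (exists2 t, r <= t & eigenvalue M t).
have [t rt|N rN N0] := resolvent_ge0 (r := r) M0.
  by apply/negP => Mt; apply: nex; exists t; rewrite // eigenvalue_root_char.
case/eqP: wn0; apply/rowP => j; apply/eqP; rewrite mxE eq_le w0 andbT.
rewrite -[w]mulmx1 -rN mulmxA mxE; apply: sumr_le0 => i _.
rewrite mulr_le0_ge0 // mulmxBr mul_mx_scalar !mxE subr_le0.
by have := wM i; rewrite !mxE.
Qed.
End Perron.

(** * Spectral radii of quivers and of Kronecker sums *)

Section SpectralRadius.
Variable R : realType.
Local Notation normc := ComplexField.Normc.normc.
Local Notation natmx Q := (map_mx (fun m : nat => m%:R : R[i]) Q).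

(** Makes [sup] a genuine upper bound; the sum of the moduli of all roots of the characteristic
    polynomial dominates each of them. *)
Lemma eigenvalue_norms_bounded n (Q : 'M[nat]_n) :
  has_ubound [set normc z | z in [set z : R[i] | eigenvalue (natmx Q) z]]%classic.
Proof.
have [s sE] := closed_field_poly_normal (char_poly (natmx Q)).
exists (\sum_(z <- s) normc z) => _ [z /= zQ <-].
have zs : z \in s.
  move: zQ; rewrite /= eigenvalue_root_char sE (monicP (char_poly_monic _)).
  by rewrite scale1r root_prod_XsubC.
rewrite (big_rem z zs) /= lerDl sumr_ge0 // => u _.
by case: u => a b; rewrite /= sqrtr_ge0.
Qed.

Lemma spectral_radius_ge0 n (Q : 'M[nat]_n) : 0 <= spectral_radius R Q.
Proof.
rewrite /spectral_radius; set E := image _ _.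
(* With no eigenvalue at all, the value is [sup set0 = 0]. *)
have [[x Ex]|/set0P/negP/negPn/eqP->] := pselect (E !=set0)%classic; last by rewrite sup0.
apply: le_trans (ub_le_sup (eigenvalue_norms_bounded Q) Ex).
by case: Ex => -[a b] _ <-; rewrite /= sqrtr_ge0.
Qed.

(** The real eigenvalue [t >= r] is also a complex one, of modulus at least [t]. *)
Lemma subinvariant_spectral_radius n (Q : 'M[nat]_n) (w : 'I_n -> R) r :
  (forall i, 0 <= w i) -> (exists i, w i != 0) ->
  (forall j, r * w j <= \sum_i w i * (Q i j)%:R) -> r <= spectral_radius R Q.
Proof.
move=> w0 [i wi] wQ; pose M : 'M[R]_n := map_mx (fun m : nat => m%:R : R) Q.
have [|||j|t rt Mt] := @subinvariant_eigenvalue R n M (\row_i w i) r.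
- by move=> i' j; rewrite mxE ler0n.
- by move=> j; rewrite mxE.
- by apply: contraNneq wi => /rowP/(_ i); rewrite !mxE => ->.
- by rewrite !mxE; apply: le_trans (wQ j) _; apply: ler_sum => l _; rewrite !mxE.
apply: le_trans rt _; apply: le_trans (ler_norm t) _.
apply: (ub_le_sup (eigenvalue_norms_bounded Q)); exists t%:C => /=; last first.
  by rewrite expr0n addr0 sqrtr_sqr.
have -> : natmx Q = map_mx (real_complex R) M.
  by apply/matrixP => a b; rewrite !mxE rmorph_nat.
by rewrite eigenvalue_map.
Qed.

(** Take the moduli of the entries of a left eigenvector and apply the triangle inequality to
    [v Q = z v]. *)
Lemma eigenvalue_subinvariant n (Q : 'M[nat]_n) z : eigenvalue (natmx Q) z ->
  exists w : 'I_n -> R, [/\ forall i, 0 <= w i, exists i, w i != 0 &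
    forall j, normc z * w j <= \sum_i w i * (Q i j)%:R].
Proof.
have n0 (x : R[i]) : 0 <= normc x by case: x => a b; rewrite /= sqrtr_ge0.
have norm_sum (I : Type) (r : seq I) (F : I -> R[i]) :
    normc (\sum_(i <- r) F i) <= \sum_(i <- r) normc (F i).
  elim: r => [|i r IH]; first by rewrite !big_nil ComplexField.Normc.normc0.
  by rewrite !big_cons; apply: le_trans (le_normcD _ _) _; rewrite lerD2l.
have norm_nat (l : nat) : normc l%:R = l%:R :> R.
  have -> : (l%:R : R[i]) = (l%:R : R)%:C by rewrite rmorph_nat.
  by rewrite /= expr0n addr0 sqrtr_sqr ger0_norm.
move=> /eigenvalueP[v vQ v0]; exists (fun i => normc (v 0 i)); split=> //.
  have [/existsP[i vi]|] := boolP [exists i, v 0 i != 0].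
    exists i; apply: contra_neq vi; exact: ComplexField.Normc.eq0_normc.
  rewrite negb_exists => /forallP v0'; case/eqP: v0; apply/rowP => i.
  by rewrite mxE; apply/eqP/negPn/v0'.
move=> j; have /rowP/(_ j) := vQ; rewrite !mxE => vj.
rewrite -ComplexField.Normc.normcM -vj; apply: le_trans (norm_sum _ _ _) _.
by apply: ler_sum => i _; rewrite mxE ComplexField.Normc.normcM norm_nat.
Qed.

Lemma spectral_radius_kron n m p (Q1 : 'M[nat]_n) (Q2 : 'M[nat]_m)
    (Q : 'M[nat]_p) (g : 'I_p -> 'I_n * 'I_m) :
  bijective g -> (0 < n)%N -> (0 < m)%N ->
  (forall x y, Q1 (g x).1 (g y).1 * ((g x).2 == (g y).2) +
     ((g x).1 == (g y).1) * Q2 (g x).2 (g y).2 <= Q x y)%N ->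
  spectral_radius R Q1 + spectral_radius R Q2 <= spectral_radius R Q.
Proof.
move=> [g' gK g'K] n0 m0 Qge.
have ne l (P : 'M[nat]_l) : (0 < l)%N -> 
  ([set normc z | z in [set z : R[i] | eigenvalue (natmx P) z]] !=set0)%classic.
  move=> l0; have [z zP] := eigenvalue_closed (natmx P) l0.
  by exists (normc z), z.
(* The suprema are eliminated one at a time; each elimination needs an eigenvalue to exist, hence
   [0 < n] and [0 < m]. *)
rewrite -lerBrDr; apply: ge_sup => [|_ [z1 /= z1Q <-]]; first exact: ne.
rewrite lerBrDr addrC -lerBrDr; apply: ge_sup => [|_ [z2 /= z2Q <-]]; first exact: ne.
rewrite lerBrDr.
have [u [u0 [i ui] uQ]] := eigenvalue_subinvariant z1Q.
have [v [v0 [j vj] vQ]] := eigenvalue_subinvariant z2Q.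
apply: (@subinvariant_spectral_radius _ _ (fun x => u (g x).1 * v (g x).2)).
- by move=> x; apply: mulr_ge0.
- by exists (g' (i, j)); rewrite g'K mulf_neq0.
move=> y; case gy: (g y) => [i' j'] /=.
apply: (@le_trans _ _ ((\sum_a u a * (Q1 a i')%:R) * v j' +
    u i' * \sum_b v b * (Q2 b j')%:R)).
  rewrite addrC mulrDl mulrA [X in _ + X]mulrCA lerD //.
    by rewrite ler_wpM2r.
  by rewrite ler_wpM2l.
have gx (F : 'I_n * 'I_m -> R) : \sum_x F (g x) = \sum_a \sum_b F (a, b).
  rewrite pair_big /= (reindex g) /=; last by exists g' => x _.
  by apply: eq_bigr => x _; case: (g x).
apply: (@le_trans _ _ (\sum_x u (g x).1 * v (g x).2 *
    (Q1 (g x).1 i' * ((g x).2 == j') + ((g x).1 == i') * Q2 (g x).2 j')%:R)).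
  rewrite (gx (fun x => u x.1 * v x.2 *
    (Q1 x.1 i' * (x.2 == j') + (x.1 == i') * Q2 x.2 j')%:R)) /=.
  (* Each of the two double sums factors into single sums, one of which is evaluated by a Kronecker
     delta. *)
  rewrite [leRHS](_ : _ = \sum_a \sum_b (u a * (Q1 a i')%:R) * (v b * (b == j')%:R)
     + \sum_a \sum_b (u a * (a == i')%:R) * (v b * (Q2 b j')%:R)); last first.
    rewrite -big_split; apply: eq_bigr => a _; rewrite -big_split.
    by apply: eq_bigr => b _ /=; rewrite natrD !natrM; ring.
  have delta l (f : 'I_l -> R) c : \sum_a f a * (a == c)%:R = f c.
    rewrite (bigD1 c) //= eqxx mulr1 big1 ?addr0 // => a /negPf->.
    by rewrite mulr0.
  under [X in _ <= X + _]eq_bigr do rewrite -mulr_sumr delta.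
  under [X in _ <= _ + X]eq_bigr do rewrite -mulr_sumr.
  by rewrite -!mulr_suml delta.
apply: ler_sum => x _; rewrite ler_wpM2l ?mulr_ge0 // ler_nat.
by have := Qge x y; rewrite gy.
Qed.
End SpectralRadius.

(** * Ext^1 as derivations modulo inner derivations *)

Definition bilinear (k : fieldType) (U V W : vectType k) (F : U -> V -> W) : Prop :=
  (forall v, linear (F^~ v)) /\ (forall u, linear (F u)).

Section Derivations.
Variables (k : fieldType) (A : falgType k).
Implicit Types M N : rmodule A.
Local Notation cover := Defs.cover.

(** These are the [D] for which [(n, m) a = (n a + D m a, m a)] is a module structure on the direct
    sum of [N] and [M]; the inner ones come from a linear change of splitting. *)
Definition derivation M N (D : M -> A -> N) : Prop :=
  [/\ forall a, linear (D^~ a), forall m, linear (D m) &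
      forall m a b, D m (a * b) = ract (D m a) b + D (ract m a) b].

Definition inner M N (D : M -> A -> N) : Prop :=
  exists f : 'Hom(M, N), forall m a, D m a = ract (f m) a - f (ract m a).

(** Linear independence in derivations modulo inner ones, phrased without a quotient space.
    [dim_ext1] is then the largest size of such a family. *)
Definition free_mod_inner M N d (D : 'I_d -> M -> A -> N) : Prop :=
  (forall i, derivation (D i)) /\
  forall c : 'I_d -> k, inner (fun m a => \sum_i c i *: D i m a) ->
    forall i, c i = 0.

Lemma derivation1 M N (D : M -> A -> N) m :
  derivation D -> D m 1 = 0.
Proof.
case=> _ _ DM; have /eqP := DM m 1 1.
by rewrite mulr1 !ract1 -subr_eq0 opprD addrA subrr add0r oppr_eq0 => /eqP.
Qed.

Lemma linear_lfun (U V : vectType k) (f : U -> V) (fl : linear f) :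
  exists g : 'Hom(U, V), g =1 f.
Proof.
pose fL := GRing.isLinear.Build k U V _ f fl.
pose f' : {linear U -> V} := HB.pack f fL.
by exists (linfun f') => x; rewrite lfunE.
Qed.

Section LinearFun.
Variables (U V : vectType k) (f : U -> V).
Hypothesis fl : linear f.

Lemma linear_fun0 : f 0 = 0.
Proof. by have [g gE] := linear_lfun fl; rewrite -gE linear0. Qed.

Lemma linear_funB x y : f (x - y) = f x - f y.
Proof. by have [g gE] := linear_lfun fl; rewrite -!gE linearB. Qed.

Lemma linear_funD x y : f (x + y) = f x + f y.
Proof. by have [g gE] := linear_lfun fl; rewrite -!gE linearD. Qed.

Lemma linear_funZ c x : f (c *: x) = c *: f x.
Proof. by have [g gE] := linear_lfun fl; rewrite -!gE linearZ. Qed.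

Lemma linear_fun_sum (I : Type) (r : seq I) (P : pred I) (F : I -> U) :
  f (\sum_(i <- r | P i) F i) = \sum_(i <- r | P i) f (F i).
Proof.
have [g gE] := linear_lfun fl; rewrite -gE linear_sum.
by apply: eq_bigr => i _; apply: gE.
Qed.
End LinearFun.

Lemma ractDZl M a c (v w : M) : ract (c *: v + w) a = c *: ract v a + ract w a.
Proof. exact: ract_linearl. Qed.

Lemma ractDZr M c a b (v : M) : ract v (c *: a + b) = c *: ract v a + ract v b.
Proof. exact: ract_linearr. Qed.

Lemma ractBl M a (v w : M) : ract (v - w) a = ract v a - ract w a.
Proof. exact: (linearB (ractr a)). Qed.

Lemma ractZl M a c (v : M) : ract (c *: v) a = c *: ract v a.
Proof. exact: (linearZ_LR (ractr a)). Qed.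

Lemma ract_suml M a (I : Type) (r : seq I) (P : pred I) (F : I -> M) :
  ract (\sum_(i <- r | P i) F i) a = \sum_(i <- r | P i) ract (F i) a.
Proof. exact: (linear_sum (ractr a)). Qed.

(** * Cocycles on the kernel [K] of the free cover [P] of [M], compared with derivations *)

Section Cocycles.
Variables M N : rmodule A.
Local Notation P := (cover_obj M).
Local Notation K := (ker_rmod (cover_hom M)).

Lemma ker_inclE M' N' (f : 'Hom(M', N')) (fA : f \in homA M' N') x :
  ker_incl fA x = vsval x.
Proof. by rewrite lfunE. Qed.

(** By exactness the image of the second differential is the kernel of [cover K], so cocycles are
    the homomorphisms that factor through [K]. *)
Lemma ext1_cyclesP (z : 'Hom(res_obj M 1, N)) :
  z \in ext1_cycles M N <->
  z \in homA (cover_obj K) N /\ forall y, cover K y = 0 -> z y = 0.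
Proof.
rewrite memv_cap memv_ker codiffE; split=> [/andP[zA /eqP z0]|[zA z0]].
  split=> // y Ky; have : y \in limg (res_diff M 1).
    by rewrite limg_comp cover_onto limg_ker_incl memv_ker Ky.
  case/memv_imgP => x _ ->.
  by have /lfunP/(_ x) := z0; rewrite comp_lfunE => ->; rewrite zero_lfunE.
apply/andP; split=> //; apply/eqP/lfunP => x; rewrite comp_lfunE zero_lfunE.
apply: z0; rewrite comp_lfunE; apply/eqP; rewrite -memv_ker ker_inclE.
exact: subvsP.
Qed.

Lemma ext1_boundsP (z : 'Hom(res_obj M 1, N)) :
  z \in ext1_bounds M N <->
  exists2 f, f \in homA P N & forall y, z y = f (vsval (cover K y)).
Proof.
split=> [/memv_imgP[f fA ->]|[f fA zE]].
  by exists f => // y; rewrite codiffE !comp_lfunE ker_inclE.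
apply/memv_imgP; exists f => //; apply/lfunP => y.
by rewrite zE codiffE !comp_lfunE ker_inclE.
Qed.

(** A section of the cover that is only [k]-linear; [omega] measures its failure to be
    [A]-linear. *)
Definition sect (m : M) : P := [ffun i => coord (vbasis {:M}) i m *: 1].

Lemma sect_linear : linear sect.
Proof. by move=> c x y; apply/ffunP => i; rewrite !ffunE linearP /= scalerDl -scalerA. Qed.

HB.instance Definition _ := GRing.isLinear.Build k M P _ sect sect_linear.

Lemma cover_sect m : cover M (sect m) = m.
Proof.
rewrite lfunE /= /cover_fun [RHS](coord_vbasis (memvf m)).
by apply: eq_bigr => i _; rewrite ffunE linearZ /= ract1.
Qed.

(* The elements (m (x) 1) a - m a (x) 1 generating the kernel of the cover. *)
Definition omega (m : M) (a : A) : K :=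
  vsproj (lker (cover M)) (ract (sect m) a - sect (ract m a)).

Lemma omegaE m a : vsval (omega m a) = ract (sect m) a - sect (ract m a).
Proof.
rewrite vsprojK // memv_ker linearB /= cover_sect.
by have /homAP-> := cover_hom M; rewrite cover_sect subrr.
Qed.

(** In the Leibniz rule the two terms [sect (m a) b] cancel. *)
Lemma omega_derivation : derivation omega.
Proof.
split=> [a c m m'|m c a a'|m a b]; apply: val_inj => /=.
- rewrite !omegaE sect_linear !ractDZl sect_linear.
  by rewrite scalerBr opprD addrACA.
- rewrite !omegaE !ractDZr sect_linear.
  by rewrite scalerBr opprD addrACA.
rewrite (ker_actE (cover_hom M)) !omegaE ractBl !ractM.
by rewrite addrA subrK.
Qed.

(** Only [k]-linear; cocycles vanish on the kernel of [cover K], so their values do not depend on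
    the choice of preimage. *)
Definition unsect : 'Hom(K, cover_obj K) := ((cover K)^-1)%VF.
Lemma unsectK x : cover K (unsect x) = x.
Proof. by rewrite limg_lfunVK // cover_onto memvf. Qed.

Lemma cover_fun_ker (x : K) : cover_fun (vsval x) = 0.
Proof. by have := subvsP x; rewrite memv_ker lfunE /= => /eqP. Qed.

(** [sect] sends basis vectors to the free generators, so the first terms of the [omega]s add up to
    [x]; the second ones add up to [sect (cover x) = 0]. *)
Lemma sum_omega (x : K) : x = \sum_(i < \dim {:M}) omega (vbasis {:M})`_i (vsval x i).
Proof.
apply: val_inj; rewrite /= linear_sum /=.
under eq_bigr do rewrite omegaE.
rewrite sumrB -[X in _ - X](linear_sum sect (index_enum _) predT).
rewrite [X in GRing.Linear.sort _ X](cover_fun_ker x) linear0 subr0.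
apply/ffunP => j; rewrite sum_ffunE (bigD1 j) //= big1 ?addr0 => [|i /negPf ij].
  by rewrite !ffunE coord_free ?(basis_free (vbasisP _)) // eqxx scale1r mul1r.
by rewrite !ffunE coord_free ?(basis_free (vbasisP _)) // ij scale0r mul0r.
Qed.

Definition cocycle_der (z : 'Hom(res_obj M 1, N)) (m : M) (a : A) : N :=
  z (unsect (omega m a)).

(** The formula is forced by [sum_omega]: a map on [K] sending [omega m a] to [D m a] must take this
    value. *)
Definition der_cocycle (D : M -> A -> N) (y : cover_obj K) : N :=
  \sum_(i < \dim {:M}) D (vbasis {:M})`_i (vsval (cover K y) i).

Lemma cocycle_der_derivation z : z \in ext1_cycles M N ->
  derivation (cocycle_der z).
Proof.
move=> /ext1_cyclesP[/homAP zA z0]; have [ol or om] := omega_derivation.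
split=> [a c m m'|m c a a'|m a b]; rewrite /cocycle_der.
- have -> : omega (c *: m + m') a = c *: omega m a + omega m' a by exact: ol.
  by rewrite !linearP.
- have -> : omega m (c *: a + a') = c *: omega m a + omega m a' by exact: or.
  by rewrite !linearP.
(* [unsect] does not commute with the action, but the discrepancy lies in the kernel of [cover K],
   where [z] vanishes. *)
rewrite om !linearD -zA; congr (_ + _); apply/eqP; rewrite -subr_eq0 -linearB.
apply/eqP/z0; rewrite linearB /= unsectK.
by have /homAP-> := cover_hom K; rewrite unsectK subrr.
Qed.

(** Extend the values of [f] on the basis to a homomorphism [g] from the free module [P]. On [x] in
    [K] it agrees with the cocycle, as the correction is [f (cover x) = f 0]. *)
Lemma cocycle_der_inner z : z \in ext1_cycles M N ->
  inner (cocycle_der z) -> z \in ext1_bounds M N.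
Proof.
move=> /ext1_cyclesP[/homAP zA z0] [f fz].
have [|g gE] := @linear_lfun P N (fun x => \sum_(i < \dim {:M}) ract (f (vbasis {:M})`_i) (x i)).
  move=> c x y; rewrite scaler_sumr -big_split; apply: eq_bigr => i _ /=.
  by rewrite !ffunE ractDZr.
have gA : g \in homA P N.
  apply/homAP => x a; rewrite !gE ract_suml; apply: eq_bigr => i _.
  by rewrite ffunE ractM.
apply/ext1_boundsP; exists g => // y.
transitivity (z (unsect (cover K y))).
  apply/eqP; rewrite -subr_eq0 -linearB; apply/eqP/z0.
  by rewrite linearB /= unsectK subrr.
transitivity (\sum_(i < \dim {:M})
    cocycle_der z (vbasis {:M})`_i (vsval (cover K y) i)).
  by rewrite {1}[cover K y]sum_omega !linear_sum.
under eq_bigr do rewrite fz.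
rewrite sumrB -[X in _ - X](linear_sum f).
by rewrite [X in GRing.Linear.sort _ X](cover_fun_ker _) linear0 subr0 gE.
Qed.

Lemma der_cocycle_linear D : derivation D -> linear (der_cocycle D).
Proof.
move=> [_ Dr _] c x y; rewrite /der_cocycle scaler_sumr -big_split.
by apply: eq_bigr => i _ /=; rewrite !linearP /= !ffunE Dr.
Qed.

(** If the cocycle is the restriction of [f : P -> N], then evaluating it at [omega m a] exhibits
    [D] as the inner derivation of [f] composed with [sect]. *)
Lemma der_cocycleP D (z : 'Hom(res_obj M 1, N)) : derivation D -> z =1 der_cocycle D ->
  z \in ext1_cycles M N /\ (z \in ext1_bounds M N -> inner D).
Proof.
move=> Dd zE; have [Dl Dr DM] := Dd.
have Dsuml (I : finType) (F : I -> M) a : D (\sum_i F i) a = \sum_i D (F i) a.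
  exact: (linear_fun_sum (Dl a) (index_enum I) predT F).
have D0l a : D 0 a = 0 by exact: linear_fun0 (Dl a).
split.
  apply/ext1_cyclesP; split=> [|y Ky]; last first.
    rewrite zE /der_cocycle Ky linear0 big1 // => i _; rewrite ffunE.
    exact: linear_fun0 (Dr _).
  apply/homAP => y a; rewrite !zE /der_cocycle ract_suml.
  have /homAP-> := cover_hom K; rewrite (ker_actE (cover_hom M)).
  (* The extra Leibniz terms sum to [D (cover x) a] with [x] in [K], hence to zero. *)
  under eq_bigr => i _ do rewrite ffunE DM.
  by rewrite big_split /= -Dsuml [X in D X](cover_fun_ker _) D0l addr0.
move=> /ext1_boundsP[f /homAP fA fE].
have [|g gE] := @linear_lfun M N (fun m => f (sect m)).
  by move=> c x y; rewrite !linearP.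
exists g => m a.
have <- : z (unsect (omega m a)) = D m a.
  rewrite zE /der_cocycle unsectK omegaE.
  (* Moving the scalar coordinates into the first argument leaves [D m a - D (m a) 1], and
     [D _ 1 = 0]. *)
  transitivity (\sum_i (D (coord (vbasis {:M}) i m *: (vbasis {:M})`_i) a -
     D (coord (vbasis {:M}) i (ract m a) *: (vbasis {:M})`_i) 1)).
    apply: eq_bigr => i _; rewrite !ffunE -scalerAl mul1r.
    rewrite (linear_funB (Dr _)) !(linear_funZ (Dr _)).
    by rewrite !(linear_funZ (Dl _)).
  by rewrite sumrB -!Dsuml -!(coord_vbasis (memvf _)) (derivation1 _ Dd) subr0.
by rewrite fE unsectK omegaE linearB /= fA !gE.
Qed.

End Cocycles.

Lemma derivation_bilinear M N (D : M -> A -> N) :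
  derivation D -> bilinear D.
Proof. by case. Qed.

Lemma derivation_sum M N d (D : 'I_d -> M -> A -> N) (c : 'I_d -> k) :
  (forall i, derivation (D i)) -> derivation (fun m a => \sum_i c i *: D i m a).
Proof.
move=> Dder; split=> [a e m m'|m e a a'|m a b].
- rewrite scaler_sumr -big_split; apply: eq_bigr => i _ /=.
  have [Dl _ _] := Dder i; have -> := Dl a e m m'.
  by rewrite scalerDr !scalerA mulrC.
- rewrite scaler_sumr -big_split; apply: eq_bigr => i _ /=.
  have [_ Dr _] := Dder i; have -> := Dr m e a a'.
  by rewrite scalerDr !scalerA mulrC.
rewrite ract_suml -big_split; apply: eq_bigr => i _ /=.
by have [_ _ ->] := Dder i; rewrite scalerDr ractZl.
Qed.

(** Take the derivations of a basis of a complement [W] of the coboundaries in the cocycles. *)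
Lemma free_mod_inner_dim_ext1 M N : exists D : 'I_(dim_ext1 M N) -> M -> A -> N,
  free_mod_inner D.
Proof.
pose W := (ext1_cycles M N :\: ext1_bounds M N)%VS.
have dW : \dim W = dim_ext1 M N.
  have := dimv_cap_compl (ext1_cycles M N) (ext1_bounds M N).
  rewrite (capv_idPr (ext1_bounds_sub M N)) /dim_ext1 => <-.
  by rewrite addKn.
rewrite -dW; exists (fun i => cocycle_der (vbasis W)`_i).
have WZ (i : 'I_(\dim W)) : (vbasis W)`_i \in ext1_cycles M N.
  apply: (subvP (diffvSl _ (ext1_bounds M N))); apply: vbasis_mem.
  by rewrite mem_nth // size_tuple.
split=> [i|c cI]; first exact: cocycle_der_derivation.
pose z := \sum_i c i *: (vbasis W)`_i.
have zW : z \in W.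
  by apply: memv_suml => i _; rewrite memvZ // vbasis_mem ?mem_nth ?size_tuple ?ltn_ord.
have zB : z \in ext1_bounds M N.
  apply: cocycle_der_inner; first by apply: memv_suml => i _; rewrite memvZ.
  case: cI => f fE; exists f => m a; rewrite -fE /cocycle_der sum_lfunE.
  by apply: eq_bigr => i _; rewrite scale_lfunE.
have z0 : z = 0.
  apply/eqP; rewrite -memv0 -(capv_diff (ext1_cycles M N) (ext1_bounds M N)).
  by rewrite capvC memv_cap zB.
by have /freeP := basis_free (vbasisP W); apply.
Qed.

(** The associated cocycles are independent and span a space meeting the coboundaries trivially, so
    the two dimensions add up inside the cocycles. *)
Lemma free_mod_inner_le M N d (D : 'I_d -> M -> A -> N) :
  free_mod_inner D -> (d <= dim_ext1 M N)%N.
Proof.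
move=> [Dder Dfree].
have /fin_all_exists[z zE] i : exists z : 'Hom(res_obj M 1, N), z =1 der_cocycle (D i).
  exact/linear_lfun/der_cocycle_linear.
have zsumE (c : 'I_d -> k) : (\sum_i c i *: z i : 'Hom(res_obj M 1, N)) =1
    der_cocycle (fun m a => \sum_i c i *: D i m a).
  move=> y; rewrite sum_lfunE /der_cocycle exchange_big; apply: eq_bigr => i _ /=.
  by rewrite scale_lfunE zE /der_cocycle scaler_sumr.
have cz (c : 'I_d -> k) : \sum_i c i *: z i \in ext1_bounds M N -> forall i, c i = 0.
  have [_ zB] := der_cocycleP (derivation_sum c Dder) (zsumE c).
  by move/zB/Dfree.
pose Z := [tuple z i | i < d].
have Zi (i : 'I_d) : Z`_i = z i by rewrite -tnth_nth tnth_mktuple.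
have ZE (c : 'I_d -> k) : \sum_i c i *: Z`_i = \sum_i c i *: z i.
  by apply: eq_bigr => i _; rewrite Zi.
have Zfree : free Z.
  by apply/freeP => c c0; apply: cz; rewrite -ZE c0 mem0v.
have dZ : \dim <<Z>> = d by rewrite (eqP Zfree) size_tuple.
have ZB : (<<Z>> :&: ext1_bounds M N = 0)%VS.
  apply/eqP; rewrite -subv0; apply/subvP => x; rewrite memv_cap memv0 => /andP[xZ].
  rewrite (coord_span xZ) ZE => /cz c0.
  by apply/eqP; rewrite big1 // => i _; rewrite c0 scale0r.
have := dimv_disjoint_sum ZB; rewrite dZ => dsum.
rewrite /dim_ext1 -(leq_add2r (\dim (ext1_bounds M N))) subnK ?dimvS ?ext1_bounds_sub //.
rewrite -dsum dimvS // subv_add ext1_bounds_sub andbT.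
apply/span_subvP => x /tnthP[i ->]; rewrite tnth_mktuple.
exact: (der_cocycleP (Dder i) (zE i)).1.
Qed.
End Derivations.

(** * Tensor products of modules *)

Section Bilift.
Variables (k : fieldType).

Section Def.
Variables (U1 U2 V1 V2 W1 W2 : vectType k).
Variables (F : U1 -> V1 -> W1) (G : U2 -> V2 -> W2).

(** The tensor product of two bilinear maps; module actions and the derivations on tensor modules
    are both instances. *)
Definition bilift (x : tensor U1 U2) (y : tensor V1 V2) : tensor W1 W2 :=
  tens_lift (fun u1 u2 => tens_lift (fun v1 v2 => tens (F u1 v1) (G u2 v2)) y) x.

Hypotheses (Fb : bilinear F) (Gb : bilinear G).

Lemma bilift_tens u1 u2 v1 v2 :
  bilift (tens u1 u2) (tens v1 v2) = tens (F u1 v1) (G u2 v2).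
Proof.
have [[Fl Fr] [Gl Gr]] := (Fb, Gb).
have inner0 w1 w2 : tens_lift (fun v1 v2 => tens (F w1 v1) (G w2 v2))
    (tens v1 v2) = tens (F w1 v1) (G w2 v2).
  apply: (@tens_lift_tens _ _ _ _ (fun v1 v2 => tens (F w1 v1) (G w2 v2))).
    by move=> v c u u'; rewrite Fr tens_linearl.
  by move=> u c v v'; rewrite Gr tens_linearr.
rewrite /bilift tens_lift_tens ?inner0 //.
  by move=> w c u u'; rewrite !inner0 -tens_linearl; congr tens; apply: Fl.
by move=> w c u u'; rewrite !inner0 -tens_linearr; congr tens; apply: Gl.
Qed.

Lemma bilift_linearl y : linear (bilift^~ y).
Proof. by move=> c x x'; rewrite /bilift linearP. Qed.

Lemma bilift_linearr x : linear (bilift x).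
Proof.
move=> c y y'; pose L i j y0 := tens_lift (fun v1 v2 =>
  tens (F (vbasis {:U1})`_i v1) (G (vbasis {:U2})`_j v2)) y0.
change (\sum_i \sum_j x i j *: L i j (c *: y + y') =
  c *: (\sum_i \sum_j x i j *: L i j y) + \sum_i \sum_j x i j *: L i j y').
rewrite scaler_sumr -big_split; apply: eq_bigr => i _.
rewrite scaler_sumr -big_split; apply: eq_bigr => j _ /=.
by rewrite /L tens_lift_linear scalerDr !scalerA [c * _]mulrC.
Qed.

End Def.
Lemma tens_ext3 (U1 U2 V1 V2 V3 V4 : vectType k) (W : lmodType k)
    (f g : tensor U1 U2 -> tensor V1 V2 -> tensor V3 V4 -> W) :
  (forall y z, linear (fun x => f x y z)) ->
  (forall y z, linear (fun x => g x y z)) ->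
  (forall x z, linear ((f x)^~ z)) -> (forall x z, linear ((g x)^~ z)) ->
  (forall x y, linear (f x y)) -> (forall x y, linear (g x y)) ->
  (forall u1 u2 v1 v2 v3 v4, f (tens u1 u2) (tens v1 v2) (tens v3 v4) =
     g (tens u1 u2) (tens v1 v2) (tens v3 v4)) ->
  forall x y z, f x y z = g x y z.
Proof.
move=> fl gl fm gm fr gr fg x y z.
apply: (tens_ext (fl y z) (gl y z)) => u1 u2.
apply: (tens_ext (fm _ z) (gm _ z)) => v1 v2.
exact: (tens_ext (fr _ _) (gr _ _)).
Qed.

Lemma ract_bilinear (A : falgType k) (M : rmodule A) : bilinear (@ract _ _ M).
Proof. by split=> ?; [apply: ract_linearl | apply: ract_linearr]. Qed.

Lemma linear_sumZ (U V : lmodType k) d (c : 'I_d -> k) (f : 'I_d -> U -> V) :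
  (forall i, linear (f i)) -> linear (fun x => \sum_i c i *: f i x).
Proof.
move=> fl e x y; rewrite scaler_sumr -big_split; apply: eq_bigr => i _ /=.
by rewrite fl scalerDr !scalerA mulrC.
Qed.

Lemma bilinear_sumZ (U V W : vectType k) d (c : 'I_d -> k) (F : 'I_d -> U -> V -> W) :
  (forall i, bilinear (F i)) -> bilinear (fun u v => \sum_i c i *: F i u v).
Proof.
by move=> Fb; split=> [v|u]; apply: linear_sumZ => i; have [] := Fb i.
Qed.

Lemma tens_ext2 (U1 U2 V1 V2 W : vectType k)
    (f f' : tensor U1 U2 -> tensor V1 V2 -> W) : bilinear f -> bilinear f' ->
  (forall u1 u2 v1 v2, f (tens u1 u2) (tens v1 v2) = f' (tens u1 u2) (tens v1 v2)) ->
  forall x y, f x y = f' x y.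
Proof.
move=> [fl fr] [fl' fr'] ff' x y; apply: (tens_ext (fl y) (fl' y)) => u1 u2.
exact: (tens_ext (fr _) (fr' _)).
Qed.

Lemma bilift_bilinear (U1 U2 V1 V2 W1 W2 : vectType k) (F : U1 -> V1 -> W1)
  (G : U2 -> V2 -> W2) : bilinear (bilift F G).
Proof. by split; [exact: bilift_linearl | exact: bilift_linearr]. Qed.

Lemma bilift_suml (U1 U2 V1 V2 W1 W2 : vectType k) d (c : 'I_d -> k)
    (F : 'I_d -> U1 -> V1 -> W1) (G : U2 -> V2 -> W2) x y :
  (forall i, bilinear (F i)) -> bilinear G ->
  \sum_i c i *: bilift (F i) G x y =
  bilift (fun u v => \sum_i c i *: F i u v) G x y.
Proof.
move=> Fb Gb; move: x y; apply: tens_ext2 => [||u1 u2 v1 v2].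
- by apply: bilinear_sumZ => i; apply: bilift_bilinear.
- exact: bilift_bilinear.
rewrite bilift_tens //; last exact: bilinear_sumZ.
rewrite (linear_fun_sum (tens_linearl _)); apply: eq_bigr => i _.
by rewrite (linear_funZ (tens_linearl _)) bilift_tens.
Qed.

Lemma bilift_sumr (U1 U2 V1 V2 W1 W2 : vectType k) d (c : 'I_d -> k)
    (F : U1 -> V1 -> W1) (G : 'I_d -> U2 -> V2 -> W2) x y :
  bilinear F -> (forall i, bilinear (G i)) ->
  \sum_i c i *: bilift F (G i) x y =
  bilift F (fun u v => \sum_i c i *: G i u v) x y.
Proof.
move=> Fb Gb; move: x y; apply: tens_ext2 => [||u1 u2 v1 v2].
- by apply: bilinear_sumZ => i; apply: bilift_bilinear.
- exact: bilift_bilinear.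
rewrite bilift_tens //; last exact: bilinear_sumZ.
rewrite (linear_fun_sum (tens_linearr _)); apply: eq_bigr => i _.
by rewrite (linear_funZ (tens_linearr _)) bilift_tens.
Qed.

End Bilift.

Section TensorModule.
Variables (k : fieldType) (A B : falgType k).
Implicit Types (M : rmodule A) (N : rmodule B).

Section Def.
Variables (M : rmodule A) (N : rmodule B).

Definition tensor_act : tensor M N -> tensor A B -> tensor M N :=
  bilift (@ract _ _ M) (@ract _ _ N).

Lemma tensor_act_tens m n a b :
  tensor_act (tens m n) (tens a b) = tens (ract m a) (ract n b).
Proof. by rewrite /tensor_act (bilift_tens (ract_bilinear M) (ract_bilinear N)). Qed.

Fact tensor_act_linearl c : linear (tensor_act^~ c).
Proof. exact: bilift_linearl. Qed.
Fact tensor_act_linearr x : linear (tensor_act x).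
Proof. exact: bilift_linearr. Qed.
Fact tensor_act1 x : tensor_act x 1 = x.
Proof.
move: x; apply: tens_ext => // [|m n]; first exact: tensor_act_linearl.
by rewrite tensor_act_tens !ract1.
Qed.

Fact tensor_actM x c c' : tensor_act x (c * c') = tensor_act (tensor_act x c) c'.
Proof.
move: x c c'; apply: tens_ext3.
- by move=> y z e x x'; rewrite tensor_act_linearl.
- by move=> y z e x x'; rewrite !tensor_act_linearl.
- by move=> y z e x x'; rewrite mulrDl -scalerAl tensor_act_linearr.
- by move=> y z e x x'; rewrite tensor_act_linearr tensor_act_linearl.
- by move=> y z e x x'; rewrite mulrDr -scalerAr tensor_act_linearr.
- by move=> y z e x x'; rewrite tensor_act_linearr.
by move=> *; rewrite tens_mul !tensor_act_tens !ractM.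
Qed.

Definition tensor_mod : rmodule (tensor A B) :=
  RModule tensor_act_linearl tensor_act_linearr tensor_act1 tensor_actM.

Lemma ract_tensE (m : M) (n : N) a b :
  ract (tens m n : tensor_mod) (tens a b) = tens (ract m a) (ract n b).
Proof. exact: tensor_act_tens. Qed.

End Def.
End TensorModule.

(** * Contractions of tensors *)

Section Contraction.
Variables (k : fieldType) (U V : vectType k).

(** The [i]-th dual basis vector applied to the left factor; all of these together determine a
    tensor. *)
Definition contr_l (i : 'I_(\dim {:U})) : tensor U V -> V :=
  tens_lift (fun u v => coord (vbasis {:U}) i u *: v).

Definition contr_r (j : 'I_(\dim {:V})) : tensor U V -> U :=
  tens_lift (fun u v => coord (vbasis {:V}) j v *: u).

Lemma contr_l_linear i : linear (contr_l i).
Proof. exact: tens_lift_linear. Qed.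

Lemma contr_r_linear j : linear (contr_r j).
Proof. exact: tens_lift_linear. Qed.

Lemma contr_l_tens i u v : contr_l i (tens u v) = coord (vbasis {:U}) i u *: v.
Proof.
rewrite /contr_l (tens_lift_tens (f := fun u v => coord (vbasis {:U}) i u *: v)) //.
  by move=> w c x y; rewrite linearP scalerDl scalerA.
by move=> w c x y; rewrite scalerDr !scalerA mulrC.
Qed.

Lemma contr_r_tens j u v : contr_r j (tens u v) = coord (vbasis {:V}) j v *: u.
Proof.
rewrite /contr_r (tens_lift_tens (f := fun u v => coord (vbasis {:V}) j v *: u)) //.
  by move=> w c x y; rewrite scalerDr !scalerA mulrC.
by move=> w c x y; rewrite linearP scalerDl scalerA.
Qed.

Lemma coord_contr_l (x : tensor U V) i j : coord (vbasis {:V}) j (contr_l i x) = x i j.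
Proof.
apply: (@tens_ext _ _ _ k^o (fun x => coord (vbasis {:V}) j (contr_l i x))
  (fun x => x i j)) => [c y z|c y z|u v].
- by rewrite contr_l_linear linearP.
- by rewrite !mxE.
by rewrite contr_l_tens linearZ mxE.
Qed.

Lemma coord_contr_r (x : tensor U V) i j : coord (vbasis {:U}) i (contr_r j x) = x i j.
Proof.
apply: (@tens_ext _ _ _ k^o (fun x => coord (vbasis {:U}) i (contr_r j x))
  (fun x => x i j)) => [c y z|c y z|u v].
- by rewrite contr_r_linear linearP.
- by rewrite !mxE.
by rewrite contr_r_tens linearZ mxE /= mulrC.
Qed.

Lemma contr_l_inj (x y : tensor U V) : (forall i, contr_l i x = contr_l i y) -> x = y.
Proof. by move=> xy; apply/matrixP => i j; rewrite -!coord_contr_l xy. Qed.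

Lemma contr_r_inj (x y : tensor U V) : (forall j, contr_r j x = contr_r j y) -> x = y.
Proof. by move=> xy; apply/matrixP => i j; rewrite -!coord_contr_r xy. Qed.

End Contraction.

Lemma coord_neq0 (k : fieldType) (V : vectType k) (v : V) : v != 0 ->
  exists i, coord (vbasis {:V}) i v != 0.
Proof.
move=> v0; apply/existsP; apply: contraR v0; rewrite negb_exists => /forallP v0.
rewrite (coord_vbasis (memvf v)) big1 // => i _.
by have /negPn/eqP-> := v0 i; rewrite scale0r.
Qed.

Lemma lfun_neq0 (k : fieldType) (U V : vectType k) (f : 'Hom(U, V)) :
  f != 0 -> exists u, f u != 0.
Proof.
move=> f0; have [//|nex] := pselect (exists u, f u != 0).
case/eqP: f0; apply/lfunP => u; rewrite zero_lfunE.
by apply/eqP/negPn/negP => fu; apply: nex; exists u.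
Qed.

Lemma tens_neq0 (k : fieldType) (U V : vectType k) (u : U) (v : V) :
  u != 0 -> v != 0 -> tens u v != 0.
Proof.
move=> /coord_neq0[i ui]; apply: contra_neq => uv0.
have := contr_l_tens i u v; rewrite uv0 (linear_fun0 (contr_l_linear _)).
by move/esym/eqP; rewrite scaler_eq0 (negPf ui) => /eqP.
Qed.

(** * Homomorphisms of tensor modules through their slices *)

Section TensorHom.
Variables (k : fieldType) (A B : falgType k).

Lemma contr_r_ract (M : rmodule A) (N : rmodule B) j (x : tensor_mod M N) a :
  contr_r j (ract x (tens a 1)) = ract (contr_r j x) a.
Proof.
move: x; apply: tens_ext => [c x y|c x y|m n].
- by rewrite ractDZl contr_r_linear.
- by rewrite contr_r_linear ractDZl.
by rewrite ract_tensE !contr_r_tens ract1 ractZl.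
Qed.

Lemma contr_l_ract (M : rmodule A) (N : rmodule B) i (x : tensor_mod M N) b :
  contr_l i (ract x (tens 1 b)) = ract (contr_l i x) b.
Proof.
move: x; apply: tens_ext => [c x y|c x y|m n].
- by rewrite ractDZl contr_l_linear.
- by rewrite contr_l_linear ractDZl.
by rewrite ract_tensE !contr_l_tens ract1 ractZl.
Qed.

Variables (M M' : rmodule A) (N N' : rmodule B).
Implicit Types F : 'Hom(tensor_mod M N, tensor_mod M' N').

Lemma slice_r F j (n : N) :
  exists f : 'Hom(M, M'), f =1 fun m => contr_r j (F (tens m n)).
Proof. by apply: linear_lfun => c x y; rewrite tens_linearl linearP contr_r_linear. Qed.

Lemma slice_l F i (m : M) :
  exists f : 'Hom(N, N'), f =1 fun n => contr_l i (F (tens m n)).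
Proof. by apply: linear_lfun => c x y; rewrite tens_linearr linearP contr_l_linear. Qed.

(** Acting by [tens a 1] fixes [n] and commutes with contraction of the right factor. *)
Lemma slice_r_hom F j n (f : 'Hom(M, M')) :
  F \in homA (tensor_mod M N) (tensor_mod M' N') ->
  f =1 (fun m => contr_r j (F (tens m n))) -> f \in homA M M'.
Proof.
move=> /homAP FA fE; apply/homAP => m a.
by rewrite !fE -contr_r_ract -FA ract_tensE ract1.
Qed.

Lemma slice_l_hom F i m (f : 'Hom(N, N')) :
  F \in homA (tensor_mod M N) (tensor_mod M' N') ->
  f =1 (fun n => contr_l i (F (tens m n))) -> f \in homA N N'.
Proof.
move=> /homAP FA fE; apply/homAP => n b.
by rewrite !fE -contr_l_ract -FA ract_tensE ract1.
Qed.

Lemma hom_tensor_ext F F' : (forall m n, F (tens m n) = F' (tens m n)) -> F = F'.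
Proof.
by move=> FF'; apply/lfunP; apply: tens_ext => // c x y; rewrite linearP.
Qed.

(** Every slice of [F] lies in [homA M M'], and a tensor with vanishing contractions is zero. *)
Lemma homA_tensor0l : homA M M' = 0%VS ->
  homA (tensor_mod M N) (tensor_mod M' N') = 0%VS.
Proof.
move=> M0; apply/eqP; rewrite -subv0; apply/subvP => F FA; rewrite memv0.
apply/eqP/hom_tensor_ext => m n; rewrite zero_lfunE; apply: contr_r_inj => j.
have [f fE] := slice_r F j n; rewrite -fE.
have := slice_r_hom FA fE; rewrite M0 memv0 => /eqP->.
by rewrite zero_lfunE (linear_fun0 (contr_r_linear _)).
Qed.

Lemma homA_tensor0r : homA N N' = 0%VS ->
  homA (tensor_mod M N) (tensor_mod M' N') = 0%VS.
Proof.
move=> N0; apply/eqP; rewrite -subv0; apply/subvP => F FA; rewrite memv0.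
apply/eqP/hom_tensor_ext => m n; rewrite zero_lfunE; apply: contr_l_inj => i.
have [f fE] := slice_l F i m; rewrite -fE.
have := slice_l_hom FA fE; rewrite N0 memv0 => /eqP->.
by rewrite zero_lfunE (linear_fun0 (contr_l_linear _)).
Qed.

End TensorHom.

(** * Bricks: scalar endomorphisms, tensor products, existence *)

Lemma homA1 (k : fieldType) (A : falgType k) (M : rmodule A) :
  \1%VF \in homA M M.
Proof. by apply/homAP => v a; rewrite !id_lfunE. Qed.

Lemma isoA_refl (k : fieldType) (A : falgType k) (M : rmodule A) : isoA M M.
Proof.
exists \1%VF; first exact: homA1.
exists \1%VF; first exact: homA1.
by split; apply/lfunP => v; rewrite comp_lfunE !id_lfunE.
Qed.

Lemma brick_neq0 (k : fieldType) (A : falgType k) (M : rmodule A) :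
  brick M -> exists m : M, m != 0.
Proof.
case=> + _; case: (vpick {:M} =P 0) => [/eqP|/eqP]; last by exists (vpick {:M}).
rewrite vpick0 => /eqP M0 /eqP[]; apply/lfunP => x.
by apply/eqP; rewrite id_lfunE zero_lfunE -memv0 -M0 memvf.
Qed.

Lemma lfun_eigenvector (k : closedFieldType) (V : vectType k) (f : 'End(V)) :
  (exists v : V, v != 0) -> exists c, exists2 v, v != 0 & f v = c *: v.
Proof.
move=> [v0 v0n0]; pose e := vbasis {:V}.
have eb : basis_of {:V} e := vbasisP _.
(* A nonzero space has a nonconstant characteristic polynomial, which then has a root in [k]. *)
have : size (char_poly (passmx.mxof e e f)) != 1.
  rewrite size_char_poly eqSS; apply: contra_neq v0n0 => d0.
  by apply/eqP; rewrite -memv0 -[0%VS](_ : {:V} = _)%VS ?memvf //; apply/eqP; rewrite -dimv_eq0 d0.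
move=> /closed_rootP[c]; rewrite -eigenvalue_root_char => /eigenvalueP[u uf u0].
exists c, (passmx.vecof e u); first by rewrite passmx.vecof_eq0.
rewrite (passmx.hom_vecof _ eb) uf scaler_sumr.
by apply: eq_bigr => i _; rewrite mxE scalerA.
Qed.

(** Schur's lemma: [f - c] kills an eigenvector, so it is not invertible and must vanish. *)
Lemma brick_scalar (k : closedFieldType) (A : falgType k) (M : rmodule A) f :
  brick M -> f \in homA M M -> exists c, forall v, f v = c *: v.
Proof.
move=> Mb fA; have [c [v v0 fv]] := lfun_eigenvector f (brick_neq0 Mb).
exists c => w; apply/eqP; rewrite -subr_eq0.
have gA : f - c *: \1%VF \in homA M M.
  by rewrite memvB // memvZ // homA1.
have gE x : (f - c *: \1%VF) x = f x - c *: x.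
  by rewrite add_lfunE opp_lfunE scale_lfunE id_lfunE.
rewrite -gE; have [->|g0] := eqVneq (f - c *: \1%VF) 0; first by rewrite zero_lfunE.
have [g' _ [_ gK]] := Mb.2 _ gA g0.
have /lfunP/(_ v) := gK; rewrite comp_lfunE gE fv subrr linear0 id_lfunE => v0'.
by rewrite -v0' eqxx in v0.
Qed.

Lemma tensor_brick (k : closedFieldType) (A B : falgType k) (M : rmodule A)
  (N : rmodule B) : brick M -> brick N -> brick (tensor_mod M N).
Proof.
move=> Mb Nb; have [m m0] := brick_neq0 Mb; have [n n0] := brick_neq0 Nb; split.
  apply/eqP => /lfunP/(_ (tens m n)); rewrite id_lfunE zero_lfunE => /eqP.
  by rewrite (negPf (tens_neq0 m0 n0)).
move=> F FA F0.
(* All slices of [F] are scalars. One left slice, at an [m] with nonzero [i]-th coordinate, gives a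
   scalar [d], and the candidate for [F] is [d] divided by that coordinate. *)
have [d dF] : exists d, forall x, F x = d *: x.
  have [i mi] := coord_neq0 m0; have [g gE] := slice_l F i m.
  have [d gd] := brick_scalar Nb (slice_l_hom FA gE).
  exists ((coord (vbasis {:M}) i m)^-1 * d).
  apply: tens_ext => [c x y|c x y|m' n'].
  - by rewrite linearP.
  - by rewrite scalerDr !scalerA mulrC.
  apply: contr_r_inj => j; have [f fE] := slice_r F j n'.
  have [c fc] := brick_scalar Mb (slice_r_hom FA fE).
  rewrite (linear_funZ (contr_r_linear _)) contr_r_tens -fE fc scalerA.
  (* The scalars [c] and [d] are compared through the single entry [(i, j)] of [F (tens m n')]. *)
  congr (_ *: _); apply: (mulfI mi); rewrite -mulrA mulVKf //.
  have <- : coord (vbasis {:N}) j (g n') = d * coord (vbasis {:N}) j n'.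
    by rewrite gd linearZ.
  by rewrite gE coord_contr_l -coord_contr_r -fE fc linearZ /= mulrC.
have d0 : d != 0.
  by apply: contra_neq F0 => d0; apply/lfunP => x; rewrite dF d0 scale0r zero_lfunE.
exists (d^-1 *: \1%VF); first by rewrite memvZ // homA1.
by split; apply/lfunP => x; rewrite comp_lfunE scale_lfunE !id_lfunE dF scalerA
  ?mulVf ?mulfV ?scale1r.
Qed.

(* A nonzero module of minimal dimension is simple, since kernels are submodules. *)
Lemma brick_exists (k : fieldType) (A : falgType k) : exists M : rmodule A, brick M.
Proof.
pose P (n : nat) := `[< exists M : rmodule A, \dim {:M} = n /\ (0 < n)%N >].
have exP : exists n, P n.
  exists (\dim {:free_rmod A 1}); apply/asboolP; exists (free_rmod A 1); split=> //.
  rewrite lt0n dimv_eq0; apply/negP => /eqP F0.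
  have : ([ffun _ => 1] : free_rmod A 1) \in 0%VS by rewrite -F0 memvf.
  by rewrite memv0 => /eqP/ffunP/(_ ord0); rewrite !ffunE => /eqP; rewrite oner_eq0.
case: (ex_minnP exP) => n /asboolP[M [dM n0]] nmin; exists M; split.
  apply/eqP => id0; have : (0 < \dim {:M})%N by rewrite dM.
  rewrite lt0n dimv_eq0 => /negP[]; rewrite -subv0; apply/subvP => v _.
  by have /lfunP/(_ v) := id0; rewrite id_lfunE zero_lfunE => ->; rewrite mem0v.
move=> f fA f0.
have dk : \dim {:ker_rmod fA} = \dim (lker f).
  by rewrite -(limg_ker_incl fA) limg_dim_eq // lker_ker_incl capv0.
have kf : lker f == 0%VS.
  rewrite -dimv_eq0 -leqn0 leqNgt; apply/negP => k0.
  have /nmin : P (\dim (lker f)) by apply/asboolP; exists (ker_rmod fA); rewrite dk.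
  rewrite -dM => /(conj (subvf (lker f)))/andP; rewrite -eqEdim => /eqP kE.
  by case/eqP: f0; apply/lfunP => v; apply/eqP; rewrite zero_lfunE -memv_ker kE memvf.
exists (f^-1)%VF; last by rewrite lker0_compfV // lker0_compVf.
apply/homAP => v a; have /lker0P f_inj := kf; apply: f_inj.
by have /homAP-> := fA; rewrite !lker0_lfunVK.
Qed.

(** * Ext^1 and semibricks of tensor products *)

Section TensorExt.
Variables (k : fieldType) (A B : falgType k).
Variables (M M' : rmodule A) (N N' : rmodule B).
Local Notation MN := (tensor_mod M N).
Local Notation MN' := (tensor_mod M' N').

Lemma bilift_derivation (F : M -> A -> M') (G : N -> B -> N') :
  bilinear F -> bilinear G ->
  (forall m n a a' b b',
    tens (F m (a * a')) (G n (b * b')) =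
    tens (ract (F m a) a') (ract (G n b) b') +
    tens (F (ract m a) a') (G (ract n b) b') :> MN') ->
  derivation (bilift F G : MN -> tensor A B -> MN').
Proof.
move=> Fb Gb FG; split; [exact: bilift_linearl | exact: bilift_linearr|].
apply: tens_ext3.
- by move=> y z e x x'; rewrite bilift_linearl.
- move=> y z e x x'.
  by rewrite bilift_linearl !ractDZl bilift_linearl scalerDr addrACA.
- by move=> x z e y y'; rewrite mulrDl -scalerAl bilift_linearr.
- move=> x z e y y'.
  by rewrite bilift_linearr ractDZl ractDZr bilift_linearl scalerDr addrACA.
- by move=> x z e y y'; rewrite mulrDr -scalerAr bilift_linearr.
- by move=> x z e y y'; rewrite ractDZr bilift_linearr scalerDr addrACA.
move=> m n a b a' b'.
by rewrite tens_mul !ract_tensE !(bilift_tens Fb Gb) ract_tensE.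
Qed.

Variables (g : 'Hom(M, M')) (h : 'Hom(N, N')).
Hypotheses (gA : g \in homA M M') (hB : h \in homA N N').

(** Includes the action, so that [bilift gact E] is the map sending [(tens m n, tens a b)] to
    [tens (g (m a)) (E n b)]. *)
Definition gact (m : M) (a : A) : M' := g (ract m a).
Definition hact (n : N) (b : B) : N' := h (ract n b).

Lemma gact_bilinear : bilinear gact.
Proof. by split=> [a|m] c x y; rewrite /gact ?ractDZl ?ractDZr linearP. Qed.

Lemma hact_bilinear : bilinear hact.
Proof. by split=> [a|m] c x y; rewrite /hact ?ractDZl ?ractDZr linearP. Qed.

(** Linearity of [h] over [B] gives both Leibniz terms of [D] the same right factor [h (n b b')]. *)
Lemma tensor_derivation_l D : derivation D ->
  derivation (bilift D hact : MN -> tensor A B -> MN').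
Proof.
move=> Dd; apply: bilift_derivation (derivation_bilinear Dd) hact_bilinear _.
move=> m n a a' b b'; have [_ _ ->] := Dd; rewrite /hact ractM.
by have /homAP hP := hB; rewrite -!hP (linear_funD (tens_linearl _)).
Qed.

Lemma tensor_derivation_r E : derivation E ->
  derivation (bilift gact E : MN -> tensor A B -> MN').
Proof.
move=> Ed; apply: bilift_derivation gact_bilinear (derivation_bilinear Ed) _.
move=> m n a a' b b'; have [_ _ ->] := Ed; rewrite /gact ractM.
by have /homAP gP := gA; rewrite -!gP (linear_funD (tens_linearr _)).
Qed.

(* Restricting an inner derivation to A and contracting the second factor
   against a vector of the image of h gives an inner derivation over A. *)
Lemma tensor_inner_l D E : derivation D -> derivation E -> h != 0 ->
  inner (fun (x : MN) c => bilift D hact x c + bilift gact E x c : MN') -> inner D.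
Proof.
move=> Dd Ed h0 [F FE].
have [n /coord_neq0[j hj]] := lfun_neq0 h0.
have [f fE] := slice_r F j n.
exists ((coord (vbasis {:N'}) j (h n))^-1 *: f) => m a.
rewrite !scale_lfunE ractZl -scalerBr; apply: (canRL (scalerK hj)).
(* At [tens a 1] the second summand vanishes because [E n 1 = 0], leaving [tens (D m a) (h n)]. *)
have := FE (tens m n) (tens a 1).
rewrite (bilift_tens (derivation_bilinear Dd) hact_bilinear).
rewrite (bilift_tens gact_bilinear (derivation_bilinear Ed)) (derivation1 _ Ed).
rewrite (linear_fun0 (tens_linearr _)) addr0 /hact ract1 => /(congr1 (contr_r j)).
rewrite contr_r_tens => ->.
by rewrite (linear_funB (contr_r_linear _)) contr_r_ract !fE ract_tensE ract1.
Qed.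

Lemma tensor_inner_r D E : derivation D -> derivation E -> g != 0 ->
  inner (fun (x : MN) c => bilift D hact x c + bilift gact E x c : MN') -> inner E.
Proof.
move=> Dd Ed g0 [F FE].
have [m /coord_neq0[i gi]] := lfun_neq0 g0.
have [f fE] := slice_l F i m.
exists ((coord (vbasis {:M'}) i (g m))^-1 *: f) => n b.
rewrite !scale_lfunE ractZl -scalerBr; apply: (canRL (scalerK gi)).
have := FE (tens m n) (tens 1 b).
rewrite (bilift_tens (derivation_bilinear Dd) hact_bilinear).
rewrite (bilift_tens gact_bilinear (derivation_bilinear Ed)) (derivation1 _ Dd).
rewrite (linear_fun0 (tens_linearl _)) add0r /gact ract1 => /(congr1 (contr_l i)).
rewrite contr_l_tens => ->.
by rewrite (linear_funB (contr_l_linear _)) contr_l_ract !fE ract_tensE ract1.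
Qed.

(** The nonvanishing conditions are conditional so that an empty family can be paired with the zero
    morphism, as happens for distinct vertices. *)
Lemma dim_ext1_tensor d e (D : 'I_d -> M -> A -> M') (E : 'I_e -> N -> B -> N') :
  free_mod_inner D -> free_mod_inner E ->
  ((0 < d)%N -> h != 0) -> ((0 < e)%N -> g != 0) ->
  (d + e <= dim_ext1 MN MN')%N.
Proof.
move=> [Dd Df] [Ed Ef] hn0 gn0.
pose X (u : 'I_(d + e)) : MN -> tensor A B -> MN' := match fintype.split u with
  | inl i => bilift (D i) hact | inr j => bilift gact (E j) end.
apply: (@free_mod_inner_le _ _ _ _ _ X); split=> [u|c cI].
  rewrite /X; case: (fintype.split u) => i; first exact: tensor_derivation_l.
  exact: tensor_derivation_r.
pose cD m a := \sum_i c (lshift e i) *: D i m a.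
pose cE n b := \sum_j c (rshift d j) *: E j n b.
have cDd : derivation cD by exact: derivation_sum.
have cEd : derivation cE by exact: derivation_sum.
have {}cI : inner (fun (x : MN) y => bilift cD hact x y + bilift gact cE x y : MN').
  case: cI => F FE; exists F => x y; rewrite -FE big_split_ord.
  rewrite -(bilift_suml _ _ _ (fun i => derivation_bilinear (Dd i)) hact_bilinear).
  rewrite -(bilift_sumr _ _ _ gact_bilinear (fun i => derivation_bilinear (Ed i))).
  congr (_ + _); apply: eq_bigr => i _; rewrite /X.
    by rewrite (unsplitK (inl i)).
  by rewrite (unsplitK (inr i)).
have cD0 i : c (lshift e i) = 0.
  apply: (Df (fun i => c (lshift e i))).
  by apply: (tensor_inner_l cDd cEd _ cI); apply: hn0; case: i; case: (d).
have cE0 j : c (rshift d j) = 0.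
  apply: (Ef (fun j => c (rshift d j))).
  by apply: (tensor_inner_r cDd cEd _ cI); apply: gn0; case: j; case: (e).
by move=> u; case: (split_ordP u) => i ->.
Qed.
End TensorExt.

(** Equal indices supply the identity, nonzero on a brick; for unequal indices the zero morphism is
    paired with the empty family [none]. *)
Lemma dim_ext1_tensor_semibrick (k : closedFieldType) (A B : falgType k) n m
    (S : 'I_n -> rmodule A) (T : 'I_m -> rmodule B) i i' j j' :
  (forall i, brick (S i)) -> (forall j, brick (T j)) ->
  (dim_ext1 (S i) (S i') * (j == j') + (i == i') * dim_ext1 (T j) (T j') <=
    dim_ext1 (tensor_mod (S i) (T j)) (tensor_mod (S i') (T j')))%N.
Proof.
move=> Sb Tb; have none (C : falgType k) (P Q : rmodule C) :
    free_mod_inner (fun (_ : 'I_0) (_ : P) (_ : C) => 0 : Q).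
  by split=> [[]|c _ []].
have [D Df] := free_mod_inner_dim_ext1 (S i) (S i').
have [E Ef] := free_mod_inner_dim_ext1 (T j) (T j').
case: (altP (i =P i')) => [ii|_]; case: (altP (j =P j')) => [jj|_]; rewrite ?muln1 ?mul1n ?muln0 //.
- subst i' j'; apply: (dim_ext1_tensor (homA1 _) (homA1 _) Df Ef) => _.
    by case: (Tb j).
  by case: (Sb i).
- subst i'; apply: (dim_ext1_tensor (homA1 _) (mem0v _) (none _ _ _) Ef) => // _.
  by case: (Sb i).
subst j'; rewrite addn0.
have := dim_ext1_tensor (mem0v _) (homA1 (T j)) Df (none _ _ _).
by rewrite addn0; apply=> // _; case: (Tb j).
Qed.

(** Distinct pairs differ in some coordinate, where the homomorphisms already vanish; an isomorphism
    would then make the identity of a brick zero. *)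
Lemma tensor_semibrick (k : closedFieldType) (A B : falgType k) n m p
    (S : 'I_n -> rmodule A) (T : 'I_m -> rmodule B) (g : 'I_p -> 'I_n * 'I_m) :
  injective g -> semibrick S -> semibrick T ->
  semibrick (fun x => tensor_mod (S (g x).1) (T (g x).2)).
Proof.
move=> g_inj [Sb Sni Sh] [Tb Tni Th].
have hom0 x y : x != y -> homA (tensor_mod (S (g x).1) (T (g x).2))
    (tensor_mod (S (g y).1) (T (g y).2)) = 0%VS.
  move=> xy; have [e1|/Sni/Sh] := eqVneq (g x).1 (g y).1; last exact: homA_tensor0l.
  have [e2|/Tni/Th] := eqVneq (g x).2 (g y).2; last exact: homA_tensor0r.
  case/eqP: xy; apply: g_inj; move: e1 e2.
  by case: (g x) (g y) => [? ?] [? ?] /= -> ->.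
have XB x : brick (tensor_mod (S (g x).1) (T (g x).2)) by exact: tensor_brick.
have nib x y : x != y -> ~ isoA (tensor_mod (S (g x).1) (T (g x).2))
    (tensor_mod (S (g y).1) (T (g y).2)).
  move=> xy [F]; rewrite hom0 // memv0 => /eqP-> [G _ [_ GF]].
  have [/eqP[]] := XB x; rewrite -GF; apply/lfunP => v.
  by rewrite comp_lfunE !zero_lfunE linear0.
split=> // x y nixy; apply: hom0; apply/eqP => xy; apply: nixy.
by rewrite xy; apply: isoA_refl.
Qed.

(** * Passage to suprema *)

Lemma nonempty_semibrick (R : realType) (k : fieldType) (A : falgType k) n
    (S : 'I_n -> rmodule A) : semibrick S ->
  exists n' (S' : 'I_n' -> rmodule A), [/\ (0 < n')%N, semibrick S' &
    spectral_radius R (ext_quiver S) <= spectral_radius R (ext_quiver S')].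
Proof.
case: n S => [|n] S Ss; last by exists n.+1, S.
have [M Mb] := brick_exists A; exists 1%N, (fun=> M); split=> //.
  split=> // i j; first by rewrite !ord1 eqxx.
  by case; apply: isoA_refl.
(* The empty quiver has no eigenvalues, as a row vector of length zero is zero, so its radius is
   [sup set0 = 0]. *)
apply: le_trans (spectral_radius_ge0 _ _); rewrite /spectral_radius.
rewrite [X in sup X](_ : _ = set0) ?sup0 //; apply/seteqP; split=> // _ [z /= zE _].
have /eigenvalueP[v _ /eqP[]] := zE.
by apply/rowP => -[].
Qed.

Theorem theorem1 (k : closedFieldType) (A B : falgType k) (R : realType) :
  (FPdim R (tensor A B) >= FPdim R A + FPdim R B)%E.
Proof.
(* The empty semibrick already contributes a nonnegative value. *)
have ge0 (C : falgType k) : (0 <= FPdim R C)%E.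
  have [M Mb] := brick_exists C.
  have S0 : semibrick (fun i : 'I_0 => M) by split=> -[].
  apply: (@le_trans _ _ (spectral_radius R (ext_quiver (fun i : 'I_0 => M)))%:E).
    by rewrite lee_fin spectral_radius_ge0.
  by apply: ereal_sup_ubound; exists 0%N, (fun i : 'I_0 => M).
have pair n (S : 'I_n -> rmodule A) m (T : 'I_m -> rmodule B) :
    semibrick S -> semibrick T ->
    ((spectral_radius R (ext_quiver S) + spectral_radius R (ext_quiver T))%:E
      <= FPdim R (tensor A B))%E.
  move=> /(nonempty_semibrick R)[n' [S' [n0 Ss Sle]]].
  move=> /(nonempty_semibrick R)[m' [T' [m0 Ts Tle]]].
  pose g (x : 'I_#|{: 'I_n' * 'I_m'}|) : 'I_n' * 'I_m' := enum_val x.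
  have gb : bijective g by exact: enum_val_bij.
  have [Sb _ _] := Ss; have [Tb _ _] := Ts.
  pose X x := tensor_mod (S' (g x).1) (T' (g x).2).
  apply: (@le_trans _ _ (spectral_radius R (ext_quiver X))%:E).
    rewrite lee_fin (le_trans (lerD Sle Tle)) //.
    apply: (spectral_radius_kron _ gb) => // x y.
    by rewrite !mxE; apply: dim_ext1_tensor_semibrick.
  apply: ereal_sup_ubound; exists #|{: 'I_n' * 'I_m'}|, X; split=> //.
  exact: tensor_semibrick (bij_inj gb) Ss Ts.
(* In the finite case the two suprema are taken one after the other, by moving the other term across
   the inequality. *)
have [->|Afin] := eqVneq (FPdim R (tensor A B)) +oo%E; first exact: leey.
have Fle n (S : 'I_n -> rmodule A) m (T : 'I_m -> rmodule B) :
    semibrick S -> semibrick T ->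
    ((spectral_radius R (ext_quiver S))%:E <=
      FPdim R (tensor A B) - (spectral_radius R (ext_quiver T))%:E)%E.
  by move=> Ss Ts; rewrite leeBrDr // -EFinD; apply: pair.
have Ale m (T : 'I_m -> rmodule B) : semibrick T ->
    (FPdim R A <= FPdim R (tensor A B) - (spectral_radius R (ext_quiver T))%:E)%E.
  by move=> Ts; apply: ge_ereal_sup => _ [n [S [Ss ->]]]; apply: Fle.
(* Moving [FPdim R A] across requires it to be finite; [Ale] with the empty semibrick over [B]
   bounds it. *)
have Ffin : FPdim R A \is a fin_num.
  have [M Mb] := brick_exists B.
  have T0 : semibrick (fun i : 'I_0 => M) by split=> -[].
  rewrite ge0_fin_numE //; apply: le_lt_trans (Ale _ _ T0) _.
  by rewrite lteBlDr // ltey.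
rewrite addeC -leeBrDr //; apply: ge_ereal_sup => _ [m [T [Ts ->]]].
by rewrite leeBrDr // addeC -leeBrDr //; apply: Ale.
Qed.
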